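(* There exist absolute constants $c,C>0$ such that the following holds. Let $n\ge1$, $\eta\in(0,1)$, and $(a,b)\in\mathcal S_\eta$ with $b$ a polynomial of degree at most $n-1$ and $a^*$ an outer polynomial; let $\boldsymbol\gamma=(\gamma_0,\dots,\gamma_{n-1})^T$ be the inverse NLFT of $(a,b)$. Suppose the layer stripping algorithm (see context) is run in floating-point arithmetic with machine precision $\epsilon_{\mathrm{ma}}$ on the exact input coefficients, producing $\hat{\boldsymbol\gamma}$. If $n^3\eta^{-5/2}\epsilon_{\mathrm{ma}}\le c$, then $$\frac{\|\hat{\boldsymbol\gamma}-\boldsymbol\gamma\|_2}{\|\boldsymbol\gamma\|_2}\le C\,n^3\eta^{-5/2}\epsilon_{\mathrm{ma}}.$$ In particular, a target relative precision $\epsilon$ is achieved with $\mathcal O(\log(n\eta^{-1}\epsilon^{-1}))$ bits of precision.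
   Context: For a Laurent polynomial $a$, $a^*(z):=\overline{a(1/\overline z)}$. $\mathcal S$ is the set of pairs $(a,b)$ of Laurent polynomials with $aa^*+bb^*=1$ and $0<a^*(0)<\infty$; the NLFT, $\boldsymbol\gamma\mapsto(a,b)$ where $\prod_{k}\frac{1}{\sqrt{1+|\gamma_k|^2}}\begin{pmatrix}1&\gamma_k z^k\\-\overline{\gamma_k}z^{-k}&1\end{pmatrix}=\begin{pmatrix}a&b\\-b^*&a^*\end{pmatrix}$ (product over the support, increasing $k$ left to right), is a bijection from compactly supported sequences onto $\mathcal S$, and its inverse is the inverse NLFT. For $\eta\in(0,1)$, $\mathcal S_\eta:=\{(a,b)\in\mathcal S:b\text{ polynomial},\ 0<\sup_{|z|=1}|b(z)|\le1-\eta\}$. A polynomial is outer if it has no zeros in the open unit disk. Layer stripping algorithm: input the coefficient vectors $\mathbf a_0=(a_{j,0})_{j=0}^{n-1}$ of $a^*$ and $\mathbf b_0=(b_{j,0})_{j=0}^{n-1}$ of $b$; for $k=0,\dots,n-1$: output $\gamma_k=b_{0,k}/a_{0,k}$, then compute the $(n-k)\times2$ matrix $(\mathbf a_k,\mathbf b_k)\,\frac{1}{\sqrt{1+|\gamma_k|^2}}\begin{pmatrix}1&-\gamma_k\\\overline{\gamma_k}&1\end{pmatrix}$, and form $\mathbf a_{k+1}$ as its first column with the last entry removed and $\mathbf b_{k+1}$ as its second column with the first entry removed (each of length $n-k-1$). In exact arithmetic this outputs the inverse NLFT $\boldsymbol\gamma$. Floating-point model: every elementary arithmetic operation (including division and square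 root) returns the exact result times $(1+\delta)$ with $|\delta|\le\epsilon_{\mathrm{ma}}$. *)

(* Defs.v *)
From HB Require Import structures.
From mathcomp Require Import all_boot all_order all_algebra.
From mathcomp Require Import complex.
From mathcomp Require Import reals.
Set Implicit Arguments. Unset Strict Implicit. Unset Printing Implicit Defensive.
Import Order.TTheory GRing.Theory Num.Theory.
Local Open Scope ring_scope.
Local Open Scope complex_scope.

(* Conventions: R is the (complete ordered) field of real numbers, given as an
   arbitrary realType; C := R[i] are the complex numbers. *)

Section Defs.
Variable R : realType.
Local Notation C := (R[i]).

(* modulus of a complex number, as a real number *)
Definition cabs (x : C) : R := ComplexField.Normc.normc x.

(* Euclidean norm of the vector (v_0, ..., v_{n-1}) *)
Definition l2norm (n : nat) (v : nat -> C) : R :=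
  Num.sqrt (\sum_(i < n) cabs (v i) ^+ 2).

(* Laurent polynomials are identified with the functions they define on C\{0}.
   For a polynomial P, [star P] is the Laurent polynomial P^*(z) = conj(P(1/conj z)). *)
Definition star (P : {poly C}) (z : C) : C := (P.[(z^*)^-1])^*.

(* 2x2 matrices *)
Definition mx2 (x y u v : C) : 'M[C]_2 :=
  \matrix_(i < 2, j < 2)
    if (i == 0 :> nat) then (if (j == 0 :> nat) then x else y)
    else (if (j == 0 :> nat) then u else v).

(* the k-th NLFT factor, evaluated at z <> 0 *)
Definition nlft_factor (g : C) (k : int) (z : C) : 'M[C]_2 :=
  (sqrtC (1 + `|g| ^+ 2))^-1 *: mx2 1 (g * z ^ k) (- (g^* * z ^ (- k))) 1.

(* NLFT of a sequence gam : int -> C supported in [-N, N]: the ordered product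
   (increasing k from left to right) of the factors over the support of gam,
   evaluated at z <> 0. *)
Definition nlft (N : nat) (gam : int -> C) (z : C) : 'M[C]_2 :=
  \prod_(i < (N + N).+1 | gam (i%:Z - N%:Z) != 0)
     nlft_factor (gam (i%:Z - N%:Z)) (i%:Z - N%:Z) z.

(* ---- Floating-point layer stripping ---- *)

(* a floating-point operation with (relative) rounding error e *)
Definition fl (e : C) (x : C) : C := x * (1 + e).

(* A rounding pattern [d k o j] gives the relative error of the operation with
   opcode o, applied to row j, in step k of the algorithm.  One step k of the
   algorithm, on the current vectors a = a_k, b = b_k (entries indexed from 0),
   returns (gamma_k, a_{k+1}, b_{k+1}).  Each elementary operation is rounded. *)
Definition ls_step (d : nat -> nat -> nat -> C) (k : nat) (a b : nat -> C)
  : C * (nat -> C) * (nat -> C) :=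
  let g := fl (d k 0%N 0%N) (b 0%N / a 0%N) in               (* gamma_k = b_0/a_0 *)
  let s := fl (d k 1%N 0%N) (g * g^*) in                      (* |gamma_k|^2 *)
  let t := fl (d k 2%N 0%N) (1 + s) in                        (* 1 + |gamma_k|^2 *)
  let r := fl (d k 3%N 0%N) (sqrtC t) in                      (* sqrt(...) *)
  let m := fl (d k 4%N 0%N) (1 / r) in                        (* 1/sqrt(...) *)
  (* first column of (a_k, b_k) * m * [[1, -g], [conj g, 1]] *)
  let col1 j := fl (d k 7%N j) (fl (d k 6%N j) (a j + fl (d k 5%N j) (b j * g^*)) * m) in
  (* second column *)
  let col2 j := fl (d k 10%N j) (fl (d k 9%N j) (b j - fl (d k 8%N j) (a j * g)) * m) in
  (g, (fun j => col1 j), (fun j => col2 j.+1)).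
  (* a_{k+1} = col1 without its last entry, b_{k+1} = col2 without its first
     entry; entries beyond the current length are never used. *)

Fixpoint ls_run (d : nat -> nat -> nat -> C) (fuel k : nat) (a b : nat -> C) : seq C :=
  match fuel with
  | 0%N => [::]
  | f.+1 => let: (g, a', b') := ls_step d k a b in g :: ls_run d f k.+1 a' b'
  end.

(* output (hat gamma_0, ..., hat gamma_{n-1}) of the floating-point layer
   stripping algorithm with rounding pattern d on input a* = A, b = B *)
Definition layer_stripping (d : nat -> nat -> nat -> C) (n : nat) (A B : {poly C}) : seq C :=
  ls_run d n 0%N (fun j => A`_j) (fun j => B`_j).

End Defs.

(* Main.v *)
Require Import Defs.
From HB Require Import structures.
From mathcomp Require Import all_boot all_order all_algebra cyclic separable cyclotomic.
From mathcomp Require Import complex.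
From mathcomp Require Import reals.
From mathcomp Require Import ring lra zify.

Set Implicit Arguments.
Unset Strict Implicit.
Unset Printing Implicit Defensive.
Import Order.TTheory GRing.Theory Num.Theory.
Local Open Scope ring_scope.

(* All rotations of the algorithm are unitary up to one common scalar per step, which
   does not affect the output.  Hence the rounding errors can be pulled back to the
   input: the computed [ghat] is the exact output for some [(A', B')] with
   [|A' - A| <= 32 n eps] and [|B' - B| <= 104 n eps (|B| + n |ghat|)] in the Euclidean
   norm.  The exact output depends on the input only through the power series
   [f = B / A mod z^n]: it is [gamma_k = sum_(j < k) y_j f_(k-j)], where [y] solves
   [(I + T^* T) y = e_0] and [T] is the lower triangular Toeplitz matrix of [f]; an energy
   estimate shows that [y] moves by at most twice the operator norm of the change of [T].
   Since [A] is outer and [|A|^2 >= eta] on the unit circle, there is a polynomial [G],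
   bounded by [2 / sqrt eta] on the circle, with [G A = 1 mod z^n]; Parseval over roots
   of unity turns this into a bound on [f] and on its perturbation.  Finally
   [|B|^2 <= 1 - A(0)^2 = 1 - prod (1 + |gamma_k|^2)^-1 <= |gamma|^2] makes the error
   relative to [|gamma|]. *)

(** * Euclidean norms *)

(** The obstacle is that the pulled-back pair [(A', B')] leaves the class: rounding preserves
    neither the identity on the circle nor the outerness of [A'], so nothing analytic may be used on
    the perturbed side. Layers are therefore applied to an arbitrary terminal pair [V]: [(1, 0)] for
    the exact sequence, the computed remainder for the floating-point one. The formula for [gamma_k]
    through the quotient holds for both, since it needs only a formal inverse of the first component
    mod [z^n]. All analysis is done on the exact [A], through [G]. The price is that perturbed
    quantities return on the right-hand sides: the perturbed quotient in the bound on its own error,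
    and the norm of [ghat] in the bound on [B' - B]. The smallness condition absorbs both. The error
    in [B] is tracked apart from that in [A] because a bound of order [n eps] for both would yield
    an absolute error only, useless when [gamma] is small. *)

Lemma cabs_ge0 (R : realType) (x : R[i]) : 0 <= cabs x.
Proof. by case: x => a b; rewrite /cabs /= sqrtr_ge0. Qed.

Lemma cabsM (R : realType) (x y : R[i]) : cabs (x * y) = cabs x * cabs y.
Proof. exact: ComplexField.Normc.normcM. Qed.

Lemma cabsD (R : realType) (x y : R[i]) : cabs (x + y) <= cabs x + cabs y.
Proof. exact: le_normcD. Qed.

Lemma cabsN (R : realType) (x : R[i]) : cabs (- x) = cabs x.
Proof. exact: normcN. Qed.

Lemma cabsB (R : realType) (x y : R[i]) : cabs (x - y) <= cabs x + cabs y.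
Proof. by rewrite -(cabsN y) cabsD. Qed.

Lemma cabs0 (R : realType) : cabs (0 : R[i]) = 0.
Proof. exact: ComplexField.Normc.normc0. Qed.

Lemma cabs1 (R : realType) : cabs (1 : R[i]) = 1.
Proof. exact: ComplexField.Normc.normc1. Qed.

Lemma cabsV (R : realType) (x : R[i]) : cabs x^-1 = (cabs x)^-1.
Proof. exact: ComplexField.Normc.normcV. Qed.

Lemma cabsX (R : realType) (x : R[i]) m : cabs (x ^+ m) = cabs x ^+ m.
Proof. by elim: m => [|m IH]; rewrite ?expr0 ?cabs1 // !exprS cabsM IH. Qed.

Lemma cabs_conj (R : realType) (x : R[i]) : cabs x^* = cabs x.
Proof.
have -> : x^* = (x^*)%C by [].
by case: x => a b; rewrite /cabs /= sqrrN.
Qed.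

Lemma cabs_eq0 (R : realType) (x : R[i]) : (cabs x == 0) = (x == 0).
Proof.
apply/eqP/eqP => [|->]; last exact: cabs0.
exact: ComplexField.Normc.eq0_normc.
Qed.

Lemma cabsE (R : realType) (x : R[i]) : `|x| = (cabs x)%:C%C.
Proof. by case: x => a b; rewrite normc_def. Qed.

Lemma cabs_sqr (R : realType) (x : R[i]) : (cabs x ^+ 2)%:C%C = x * x^*.
Proof. by rewrite rmorphXn /= -cabsE sqr_normc. Qed.

Lemma cabs_real (R : realType) (x : R) : 0 <= x -> cabs x%:C%C = x.
Proof. by move=> x0; rewrite /cabs /= expr0n /= addr0 sqrtr_sqr ger0_norm. Qed.

Lemma cabs_sum (R : realType) (n : nat) (F : nat -> R[i]) :
  cabs (\sum_(i < n) F i) <= \sum_(i < n) cabs (F i).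
Proof.
elim: n => [|n IH]; first by rewrite !big_ord0 cabs0.
by rewrite !big_ord_recr /=; apply: le_trans (cabsD _ _) _; rewrite lerD2r.
Qed.

Lemma sum_mul_le_sqrt (R : realType) (n : nat) (x y : nat -> R) :
  (forall i, 0 <= x i) -> (forall i, 0 <= y i) ->
  \sum_(i < n) x i * y i <=
  Num.sqrt (\sum_(i < n) x i ^+ 2) * Num.sqrt (\sum_(i < n) y i ^+ 2).
Proof.
move=> x0 y0; elim: n => [|n IH]; first by rewrite !big_ord0 sqrtr0 mulr0.
rewrite !big_ord_recr /=.
have X0 : 0 <= \sum_(i < n) x i ^+ 2 by apply: sumr_ge0 => i _; exact: sqr_ge0.
have Y0 : 0 <= \sum_(i < n) y i ^+ 2 by apply: sumr_ge0 => i _; exact: sqr_ge0.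
have S0 : 0 <= \sum_(i < n) x i * y i by apply: sumr_ge0 => i _; rewrite mulr_ge0.
move: IH S0; set S := \sum_(i < n) x i * y i.
have := sqr_sqrtr X0; have := sqr_sqrtr Y0.
have := sqrtr_ge0 (\sum_(i < n) x i ^+ 2); have := sqrtr_ge0 (\sum_(i < n) y i ^+ 2).
set p := Num.sqrt (\sum_(i < n) x i ^+ 2); set q := Num.sqrt (\sum_(i < n) y i ^+ 2).
move=> q0 p0 <- <- IH S0; rewrite -sqrtrM ?addr_ge0 ?sqr_ge0 //.
apply: le_trans (ler_norm _) _; rewrite -sqrtr_sqr; apply: ler_wsqrtr.
have xy0 := mulr_ge0 (x0 n) (y0 n).
have h1 : S * (x n * y n) <= p * q * (x n * y n) by rewrite ler_wpM2r.
have h2 : S ^+ 2 <= (p * q) ^+ 2 by rewrite ler_sqr ?nnegrE ?mulr_ge0.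
(* This square dominates the cross term [2 p q x_n y_n] in the expanded product. *)
have h3 : 0 <= (p * y n - q * x n) ^+ 2 by exact: sqr_ge0.
by nra.
Qed.

Lemma l2norm_ge0 (R : realType) n (v : nat -> R[i]) : 0 <= l2norm n v.
Proof. exact: sqrtr_ge0. Qed.

Lemma l2norm_sqr (R : realType) n (v : nat -> R[i]) :
  l2norm n v ^+ 2 = \sum_(i < n) cabs (v i) ^+ 2.
Proof. by rewrite sqr_sqrtr // sumr_ge0 // => i _; exact: sqr_ge0. Qed.

Lemma l2norm_le_of_sqr (R : realType) n (v : nat -> R[i]) (y : R) :
  0 <= y -> \sum_(i < n) cabs (v i) ^+ 2 <= y ^+ 2 -> l2norm n v <= y.
Proof. by move=> y0 h; rewrite -(ler_sqr (l2norm_ge0 _ _)) // l2norm_sqr. Qed.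

Lemma l2norm_CauchySchwarz (R : realType) n (u v : nat -> R[i]) :
  cabs (\sum_(i < n) u i * v i) <= l2norm n u * l2norm n v.
Proof.
apply: le_trans (cabs_sum n (fun i => u i * v i)) _; under eq_bigr do rewrite cabsM.
exact: (sum_mul_le_sqrt n (fun i => cabs_ge0 (u i)) (fun i => cabs_ge0 (v i))).
Qed.

Lemma l2norm_le_comb (R : realType) n (v a b : nat -> R[i]) (s t : R) :
  0 <= s -> 0 <= t ->
  (forall i, (i < n)%N -> cabs (v i) <= s * cabs (a i) + t * cabs (b i)) ->
  l2norm n v <= s * l2norm n a + t * l2norm n b.
Proof.
move=> s0 t0 H; apply: l2norm_le_of_sqr.
  by rewrite addr_ge0 // mulr_ge0 // l2norm_ge0.
have cs := @sum_mul_le_sqrt R n (fun i => cabs (a i)) (fun i => cabs (b i))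
  (fun i => cabs_ge0 _) (fun i => cabs_ge0 _).
apply: (@le_trans _ _ (\sum_(i < n) (s ^+ 2 * cabs (a i) ^+ 2
   + 2 * s * t * (cabs (a i) * cabs (b i)) + t ^+ 2 * cabs (b i) ^+ 2))).
  apply: ler_sum => i _.
  have h := H i (ltn_ord i).
  have -> : s ^+ 2 * cabs (a i) ^+ 2 + 2 * s * t * (cabs (a i) * cabs (b i)) +
    t ^+ 2 * cabs (b i) ^+ 2 = (s * cabs (a i) + t * cabs (b i)) ^+ 2 by ring.
  by rewrite ler_sqr ?nnegrE ?addr_ge0 ?mulr_ge0 ?cabs_ge0.
rewrite !big_split /= -!mulr_sumr -!l2norm_sqr.
have st := mulr_ge0 s0 t0.
move: cs; rewrite -/(l2norm n a) -/(l2norm n b) => cs.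
have := ler_wpM2l st cs; nra.
Qed.

Lemma l2norm_mono (R : realType) n (v a : nat -> R[i]) (s : R) :
  0 <= s -> (forall i, (i < n)%N -> cabs (v i) <= s * cabs (a i)) ->
  l2norm n v <= s * l2norm n a.
Proof.
move=> s0 H; have := @l2norm_le_comb R n v a a s 0 s0 (lexx _).
by rewrite mul0r addr0; apply => i lti; rewrite mul0r addr0; exact: H.
Qed.

Lemma eq_l2norm (R : realType) n (u v : nat -> R[i]) :
  (forall i, (i < n)%N -> u i = v i) -> l2norm n u = l2norm n v.
Proof.
by move=> H; rewrite /l2norm; congr Num.sqrt; apply: eq_bigr => i _; rewrite H.
Qed.

Lemma l2normD (R : realType) n (u v : nat -> R[i]) :
  l2norm n (fun i => u i + v i) <= l2norm n u + l2norm n v.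
Proof.
have := @l2norm_le_comb R n (fun i => u i + v i) u v 1 1 ler01 ler01.
by rewrite !mul1r; apply => i _; rewrite !mul1r cabsD.
Qed.

Lemma l2norm_sum (R : realType) n m (u : nat -> nat -> R[i]) :
  l2norm n (fun i => \sum_(j < m) u j i) <= \sum_(j < m) l2norm n (u j).
Proof.
elim: m => [|m IH].
  rewrite big_ord0; apply: l2norm_le_of_sqr => //.
  by rewrite big1 ?expr0n // => i _; rewrite big_ord0 cabs0 expr0n.
rewrite big_ord_recr /=; apply: le_trans (lerD IH (lexx _)).
rewrite (_ : l2norm _ _ =
  l2norm n (fun i => (fun i => \sum_(j < m) u j i) i + u m i)).
  exact: l2normD.
by apply: eq_l2norm => i _; rewrite big_ord_recr.
Qed.

Lemma cabs_le_l2norm (R : realType) n (v : nat -> R[i]) i :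
  (i < n)%N -> cabs (v i) <= l2norm n v.
Proof.
move=> lti; rewrite -(ler_sqr (cabs_ge0 _)) ?nnegrE ?l2norm_ge0 // l2norm_sqr.
rewrite (bigD1 (Ordinal lti)) //= lerDl sumr_ge0 // => j _; exact: sqr_ge0.
Qed.

Lemma l1_le_l2norm (R : realType) n (v : nat -> R[i]) :
  \sum_(i < n) cabs (v i) <= Num.sqrt n%:R * l2norm n v.
Proof.
have := @sum_mul_le_sqrt R n (fun=> 1) (fun i => cabs (v i))
  (fun i => ler01) (fun i => cabs_ge0 _).
rewrite -/(l2norm n v).
under eq_bigr do rewrite mul1r.
by under [X in Num.sqrt X]eq_bigr do rewrite expr1n; rewrite sumr_const card_ord.
Qed.

Lemma l2norm_le_const (R : realType) n (v : nat -> R[i]) (y : R) :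
  0 <= y -> (forall i, (i < n)%N -> cabs (v i) <= y) ->
  l2norm n v <= Num.sqrt n%:R * y.
Proof.
move=> y0 H; apply: l2norm_le_of_sqr; first by rewrite mulr_ge0 ?sqrtr_ge0.
rewrite exprMn sqr_sqrtr ?ler0n // mulr_natl.
rewrite -[X in _ *+ X](card_ord n) -sumr_const; apply: ler_sum => i _.
by rewrite ler_sqr ?nnegrE ?cabs_ge0 // H.
Qed.

Lemma l2norm_widen (R : realType) m n (v : nat -> R[i]) :
  (m <= n)%N -> l2norm m v <= l2norm n v.
Proof.
move=> lemn; apply: ler_wsqrtr; rewrite (big_ord_widen n (fun i => cabs (v i) ^+ 2) lemn).
rewrite [leRHS](bigID (fun i : 'I_n => (i < m)%N)) /= lerDl.
by apply: sumr_ge0 => i _; exact: sqr_ge0.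
Qed.

Lemma l2norm_XM_recr (R : realType) n (p : {poly R[i]}) :
  l2norm n.+1 (fun i => ('X * p)`_i) = l2norm n (fun i => p`_i).
Proof.
rewrite /l2norm big_ord_recl (_ : cabs _ ^+ 2 = 0) ?add0r; last first.
  by rewrite coefXM eqxx cabs0 expr0n.
by congr Num.sqrt; apply: eq_bigr => i _; rewrite coefXM.
Qed.

Lemma l2norm_XnM (R : realType) n j (p : {poly R[i]}) :
  l2norm n (fun i => ('X^j * p)`_i) <= l2norm n (fun i => p`_i).
Proof.
elim: j => [|j IH]; first by rewrite expr0 mul1r.
apply: le_trans IH; rewrite exprS -mulrA; case: n => [|n].
  by rewrite /l2norm !big_ord0.
by rewrite l2norm_XM_recr l2norm_widen.
Qed.

(** Young's inequality for truncated products: multiplication by [p] is a combination of the shifts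
    ['X^j], which only push entries past index [n]. *)
Lemma l2norm_convolution (R : realType) n (p q : {poly R[i]}) :
  l2norm n (fun i => (p * q)`_i) <=
  (\sum_(i < n) cabs p`_i) * l2norm n (fun i => q`_i).
Proof.
rewrite (_ : l2norm n _ =
  l2norm n (fun i => \sum_(j < n) (fun j i => p`_j * ('X^j * q)`_i) j i)).
  apply: le_trans (l2norm_sum n n (fun j i => p`_j * ('X^j * q)`_i)) _; rewrite mulr_suml; apply: ler_sum => j _.
  apply: (@le_trans _ _ (cabs p`_j * l2norm n (fun i => ('X^j * q)`_i))).
    by apply: l2norm_mono => [|i _]; rewrite ?cabs_ge0 // cabsM.
  apply: ler_wpM2l; first exact: cabs_ge0.
  exact: l2norm_XnM.
apply: eq_l2norm => i lti; rewrite coefM (big_ord_widen n (fun j => p`_j * q`_(i - j))) //.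
rewrite big_mkcond; apply: eq_bigr => j _; rewrite coefXnM ltnS leqNgt.
by case: ltnP => //= _; rewrite mulr0.
Qed.

(** * Multipliers on the unit circle and inverses of outer polynomials *)

Lemma complex_prim_root_exists (R : realType) (n : nat) :
  (0 < n)%N -> exists w : R[i], n.-primitive_root w.
Proof.
move=> n_gt0; pose p : {poly R[i]} := 'X^n - 1.
have [r Dp] := closed_field_poly_normal p.
rewrite (monicP _) ?monicXnsubC // scale1r in Dp.
have rn1 : all n.-unity_root r by apply/allP=> z; rewrite -root_prod_XsubC -Dp.
have sz_r : (n < (size r).+1)%N by rewrite -(size_prod_XsubC r id) -Dp size_XnsubC.
have [|z] := hasP (has_prim_root n_gt0 rn1 _ sz_r); last by exists z.
by rewrite -separable_prod_XsubC -Dp separable_Xn_sub_1 // pnatr_eq0 -lt0n.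
Qed.

Lemma cabs_prim_root (R : realType) n (w : R[i]) :
  n.-primitive_root w -> cabs w = 1.
Proof.
move=> pw; have := congr1 (@cabs R) (prim_expr_order pw).
rewrite cabsX cabs1 => /eqP; rewrite pexpr_eq1 ?cabs_ge0 ?(prim_order_gt0 pw) //.
by move/eqP.
Qed.

Lemma conj_unit_circle (R : realType) (z : R[i]) : cabs z = 1 -> z^* = z^-1.
Proof.
move=> z1; have zz : z * z^* = 1 by rewrite -cabs_sqr z1 expr1n.
have z0 : z != 0 by rewrite -cabs_eq0 z1 oner_eq0.
by apply: (mulfI z0); rewrite zz divff.
Qed.

Lemma sum_prim_root (R : realType) n (w : R[i]) (j l : 'I_n) :
  n.-primitive_root w ->
  \sum_(i < n) (w ^+ j / w ^+ l) ^+ i = (n%:R *+ (j == l)).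
Proof.
move=> pw; have w0 : w != 0 by rewrite -cabs_eq0 (cabs_prim_root pw) oner_eq0.
have [->|njl] := eqVneq j l.
  rewrite divff ?expf_neq0 //; under eq_bigr do rewrite expr1n.
  by rewrite sumr_const card_ord mulr1n.
have x1 : w ^+ j / w ^+ l - 1 != 0.
  rewrite subr_eq0; apply: contra njl => /eqP h.
  have : w ^+ j == w ^+ l.
    by rewrite -[w ^+ j](divfK (expf_neq0 l w0)) h mul1r.
  by rewrite (eq_prim_root_expr pw) !modn_small // => /eqP/val_inj->.
apply: (mulfI x1); rewrite -subrX1 mulr0.
by rewrite expr_div_n -!exprM !(mulnC _ n) !exprM (prim_expr_order pw) !expr1n divr1 subrr.
Qed.

(** Replaces integration over the circle. It follows from orthogonality of the characters,
    [sum_prim_root]; the size condition rules out aliasing. *)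
Lemma parseval_prim_root (R : realType) n (w : R[i]) (p : {poly R[i]}) :
  n.-primitive_root w -> (size p <= n)%N ->
  \sum_(i < n) cabs p.[w ^+ i] ^+ 2 = n%:R * l2norm n (fun i => p`_i) ^+ 2.
Proof.
move=> pw sp; rewrite l2norm_sqr; apply: (@complexI R).
rewrite rmorphM rmorph_nat !rmorph_sum /= mulr_sumr.
have w1 := cabs_prim_root pw.
transitivity (\sum_(j < n) \sum_(l < n) p`_j * (p`_l)^* *
    \sum_(i < n) (w ^+ j / w ^+ l) ^+ i).
  under [RHS]eq_bigr do under eq_bigr do rewrite mulr_sumr.
  under [RHS]eq_bigr do rewrite exchange_big /=.
  rewrite exchange_big /=; apply: eq_bigr => i _.
  rewrite cabs_sqr (horner_coef_wide _ sp).
  rewrite rmorph_sum mulr_suml.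
  apply: eq_bigr => j _; rewrite mulr_sumr; apply: eq_bigr => l _.
  rewrite rmorphM /= (@conj_unit_circle _ (w ^+ i ^+ l)); last first.
    by rewrite !cabsX w1 !expr1n.
  by rewrite expr_div_n -!exprM (mulnC i l) (mulnC i j); ring.
apply: eq_bigr => j _; rewrite (bigD1 j) //= [X in _ + X]big1 ?addr0.
  by rewrite sum_prim_root // eqxx mulr1n mulrC cabs_sqr.
by move=> l njl; rewrite sum_prim_root // eq_sym (negbTE njl) mulr0n mulr0.
Qed.

(** Truncated multiplication is a compression of multiplication on the circle, so the sup of [G]
    controls it; [l2norm_convolution] would cost the sum of the moduli of the coefficients
    instead. *)
Lemma l2norm_multiplier (R : realType) n (G r : {poly R[i]}) (K : R) :
  0 <= K -> (forall z, cabs z = 1 -> cabs G.[z] <= K) ->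
  l2norm n (fun i => (G * r)`_i) <= K * l2norm n (fun i => r`_i).
Proof.
move=> K0 HG; pose s := \poly_(i < n) r`_i.
have sr : forall i, (i < n)%N -> s`_i = r`_i by move=> i lti; rewrite coef_poly lti.
rewrite (@eq_l2norm R n _ (fun i => (G * s)`_i)); last first.
  move=> i lti; rewrite !coefM; apply: eq_bigr => j _.
  by rewrite sr // (leq_ltn_trans (leq_subr _ _)).
rewrite (@eq_l2norm R n (fun i => r`_i) (fun i => s`_i)); last by move=> i /sr.
(* With this many sample points Parseval is exact for both [G * s] and [s]. Passing from [n] to [M]
   entries can only enlarge the left norm and does not change that of [s]. *)
pose M := (size (G * s)%R + n).+1.
have [w pw] := @complex_prim_root_exists R M isT.
have nM : (n <= M)%N by rewrite /M; lia.
apply: le_trans (l2norm_widen _ nM) _.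
have ss : (size s <= n)%N by exact: size_poly.
have -> : l2norm n (fun i => s`_i) = l2norm M (fun i => s`_i).
  apply/eqP; rewrite eq_le l2norm_widen //=; apply: ler_wsqrtr.
  rewrite (big_ord_widen M (fun i => cabs s`_i ^+ 2) nM) [leRHS]big_mkcond /=.
  apply: ler_sum => i _; case: ltnP => // le_ni.
  by rewrite nth_default ?cabs0 ?expr0n // (leq_trans ss).
rewrite -(ler_sqr (l2norm_ge0 _ _)) ?nnegrE ?mulr_ge0 ?l2norm_ge0 //.
have M0 : 0 < M%:R :> R by rewrite ltr0n.
rewrite -(ler_pM2l M0) exprMn [M%:R * (K ^+ 2 * _)]mulrCA -!(parseval_prim_root pw) /M; try lia.
rewrite mulr_sumr; apply: ler_sum => i _; rewrite hornerM cabsM exprMn.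
rewrite ler_wpM2r ?sqr_ge0 // ler_sqr ?nnegrE ?cabs_ge0 // HG //.
by rewrite cabsX (cabs_prim_root pw) expr1n.
Qed.

Lemma exp_cabs_inv_small (R : realType) (x : R[i]) (e : R) :
  1 < cabs x -> 0 < e ->
  exists m0 : nat, forall m, (m0 <= m)%N -> cabs (x ^- m) <= e.
Proof.
move=> x1 e0; pose t := cabs x - 1; have t0 : 0 < t by rewrite subr_gt0.
have te0 : 0 < (t * e)^-1 by rewrite invr_gt0 mulr_gt0.
exists (Num.bound (t * e)^-1) => m lem.
have := archi_boundP (ltW te0).
set k := Num.bound _ in lem *; move=> hk.
have Bern : 1 + m%:R * t <= cabs x ^+ m.
  elim: m {lem} => [|m IH]; first by rewrite mul0r addr0 expr0.
  have xt : cabs x = 1 + t by rewrite /t; ring.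
  rewrite exprS; apply: (@le_trans _ _ (cabs x * (1 + m%:R * t))); last first.
    by rewrite ler_wpM2l ?cabs_ge0.
  rewrite xt -natr1; have : 0 <= m%:R * t * t by rewrite !mulr_ge0 ?ler0n // ltW.
  by nra.
rewrite cabsV cabsX.
have xm0 : 0 < cabs x ^+ m by rewrite exprn_gt0 // (lt_trans ltr01).
rewrite -(ler_pM2l xm0) mulfV ?gt_eqF //.
have hm : (t * e)^-1 <= m%:R by rewrite (le_trans (ltW hk)) // ler_nat.
have : 1 <= m%:R * (t * e) by rewrite -ler_pdivrMr ?mulr_gt0 // mul1r.
have := ler_wpM2r (ltW e0) Bern; nra.
Qed.

(** A geometric sum of length [m] inverts [1 - z / x] up to [1 - (z / x)^m], whose modulus on the
    circle is nearly [1] because [|x| > 1]. Allowing every [K > 1] and every large [m] lets all the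
    roots share one [m] in the induction. *)
Lemma outer_prod_inverse (R : realType) (rs : seq R[i]) :
  (forall x, x \in rs -> 1 < cabs x) -> forall K : R, 1 < K ->
  exists m0 : nat, forall m, (m0 <= m)%N -> exists G E : {poly R[i]},
    \prod_(x <- rs) (1 - x^-1 *: 'X) * G = 1 + 'X^m * E /\
    forall z, cabs z = 1 -> cabs (1 + 'X^m * E).[z] <= K.
Proof.
elim: rs => [|x rs IH] Hrs K K1.
  exists 0%N => m _; exists 1, 0; rewrite big_nil mulr0 addr0 mul1r; split => // z _.
  by rewrite hornerC cabs1 ltW.
have Hrs' y : y \in rs -> 1 < cabs y by move=> yrs; apply: Hrs; rewrite inE yrs orbT.
pose L := (1 + K) / 2; have L1 : 1 < L by rewrite /L; lra.
have [m1 H1] := IH Hrs' L L1.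
(* Chosen so that [(1 + e) * L = K]: the new factor gets [1 + e], the remaining roots get [L]. *)
pose e := (K - L) / L.
have L0 : 0 < L by lra.
have e0 : 0 < e by rewrite /e divr_gt0 // /L; lra.
have x1 : 1 < cabs x by apply: Hrs; rewrite inE eqxx.
have [m2 H2] := exp_cabs_inv_small x1 e0.
exists (maxn m1 m2) => m; rewrite geq_max => /andP[le1 le2].
have [G [E [HG HE]]] := H1 m le1.
exists ((\sum_(i < m) (x^-1 *: 'X) ^+ i) * G).
exists (E - x ^- m *: (1 + 'X^m * E)).
have EP : 1 + 'X^m * (E - x ^- m *: (1 + 'X^m * E)) =
    (1 - x ^- m *: 'X^m) * (1 + 'X^m * E) :> {poly R[i]}.
  by rewrite -!mul_polyC; ring.
rewrite EP; split.
  rewrite big_cons -HG.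
  have -> : 1 - x ^- m *: 'X^m = (1 - x^-1 *: 'X) * (\sum_(i < m) (x^-1 *: 'X) ^+ i) :> {poly R[i]}.
    have := subrX1 (x^-1 *: 'X : {poly R[i]}) m.
    rewrite exprZn exprVn => h; rewrite -[1 - _]opprB h; ring.
  ring.
move=> z z1; rewrite hornerM cabsM.
have hE := HE z z1; have h2 := H2 m le2.
have : cabs (1 - x ^- m *: 'X^m).[z] <= 1 + e.
  rewrite !hornerE; apply: le_trans (cabsB _ _) _.
  by rewrite cabs1 cabsM cabsX z1 expr1n mulr1 lerD2l.
have -> : K = (1 + e) * L by rewrite /e mulrDl mul1r divfK ?gt_eqF //; ring.
by move=> h; rewrite ler_pM ?cabs_ge0.
Qed.

(** Taking [K = 2] above gives [|G A| <= 2] on the circle, hence [|G| <= 2 / |A|]. [G] shares its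
    first [n] coefficients with the series of [1 / A] but is not its truncation, for which no such
    bound is at hand. *)
Lemma outer_poly_inverse (R : realType) (n : nat) (A : {poly R[i]}) (h : R) :
  (forall z, cabs z <= 1 -> A.[z] != 0) ->
  (forall z, cabs z = 1 -> 1 <= h * cabs A.[z]) ->
  exists G : {poly R[i]},
    (forall j, (j < n)%N -> (G * A)`_j = (j == 0%N)%:R) /\
    (forall z, cabs z = 1 -> cabs G.[z] <= 2 * h).
Proof.
have key (g a : R) : 0 <= g -> 0 <= a -> g * a <= 2 -> 1 <= h * a -> g <= 2 * h.
  move=> g0 a0 ga ha; have h0 : 0 <= h by rewrite leNgt; apply/negP => hn; nra.
  have := ler_wpM2l h0 ga; have := ler_wpM2l g0 ha; nra.
move=> HA Hh; have [rs Drs] := closed_field_poly_normal A.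
have A0 : A != 0 by apply: contraTneq (HA 0 _) => [->|]; rewrite ?hornerC ?eqxx ?cabs0.
have Hrs x : x \in rs -> 1 < cabs x.
  move=> xrs; rewrite ltNge; apply/negP => /HA; apply/negP/negPn.
  by rewrite -/(root A x) Drs rootZ ?lead_coef_eq0 // root_prod_XsubC.
have [c c0 Dc] : exists2 c, c != 0 & A = c *: \prod_(x <- rs) (1 - x^-1 *: 'X).
  have : exists2 d, d != 0 &
      \prod_(x <- rs) ('X - x%:P) = d *: \prod_(x <- rs) (1 - x^-1 *: 'X).
    elim: rs {Drs} Hrs => [|x rs IH] Hrs.
      by exists 1; rewrite ?oner_eq0 // !big_nil scale1r.
    have [|d d0 Hd] := IH; first by move=> y yrs; apply: Hrs; rewrite inE yrs orbT.
    have x0 : x != 0.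
      rewrite -cabs_eq0 gt_eqF // (lt_trans ltr01) // Hrs //.
      by rewrite inE eqxx.
    exists (- x * d); first by rewrite mulf_neq0 // oppr_eq0.
    rewrite !big_cons Hd.
    have -> : 'X - x%:P = (- x) *: (1 - x^-1 *: 'X) :> {poly R[i]}.
      rewrite scalerBr scalerA mulNr divff // scaleN1r opprK addrC.
      by rewrite scaleNr -mul_polyC mulr1.
    by rewrite -scalerAl -scalerAr scalerA.
  case=> d d0 Hd; exists (lead_coef A * d); first by rewrite mulf_neq0 ?lead_coef_eq0.
  by rewrite {1}Drs Hd scalerA.
have [m0 Hm] := @outer_prod_inverse R rs Hrs 2 ltac:(lra).
have [G [E [HG HE]]] := Hm (maxn m0 n) (leq_maxl _ _).
set m := maxn m0 n in HG HE.
have HGA : c^-1 *: G * A = 1 + 'X^m * E.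
  rewrite -HG Dc -scalerAl -scalerAr scalerA mulVf // scale1r mulrC //.
exists (c^-1 *: G); split => [j ltj|z z1].
  rewrite HGA coefD coef1 coefXnM (leq_trans ltj (leq_maxr _ _)) addr0 //.
have := HE z z1; rewrite -HGA hornerM cabsM => hz.
by apply: key hz (Hh z z1); exact: cabs_ge0.
Qed.

(** * The nonlinear Fourier transform as a composition of layers *)

Definition cnorm (R : realType) (g : R[i]) : R[i] := (sqrtC (1 + `|g| ^+ 2))^-1.

Lemma cnorm_gt0 (R : realType) (g : R[i]) : 0 < cnorm g.
Proof. by rewrite invr_gt0 sqrtC_gt0 ltr_pwDl ?exprn_ge0. Qed.

Lemma cnorm_neq0 (R : realType) (g : R[i]) : cnorm g != 0.
Proof. by rewrite gt_eqF // cnorm_gt0. Qed.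

Lemma one_addr_conj_neq0 (R : realType) (g : R[i]) : 1 + g * g^* != 0.
Proof. by rewrite -normCK gt_eqF // ltr_pwDl ?exprn_ge0. Qed.

Lemma cnorm_sqr (R : realType) (g : R[i]) : cnorm g ^+ 2 * (1 + g * g^*) = 1.
Proof. by rewrite exprVn sqrtCK -normCK mulVf // normCK one_addr_conj_neq0. Qed.

Lemma conj_cnorm (R : realType) (g : R[i]) : (cnorm g)^* = cnorm g.
Proof. by apply: CrealP; rewrite gtr0_real // cnorm_gt0. Qed.

Lemma cabs_cnorm_sqr (R : realType) (g : R[i]) :
  cabs (cnorm g) ^+ 2 * (1 + cabs g ^+ 2) = 1.
Proof.
apply: (@complexI R); rewrite rmorphM rmorphD /= !cabs_sqr conj_cnorm rmorph1.
exact: cnorm_sqr.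
Qed.

Lemma cabs_cnorm_le1 (R : realType) (g : R[i]) : cabs (cnorm g) <= 1.
Proof.
have := cabs_cnorm_sqr g; have := cabs_ge0 (cnorm g); have := sqr_ge0 (cabs g).
by rewrite leNgt => *; apply/negP => h; nra.
Qed.

Lemma cabs_cnormM_le1 (R : realType) (g : R[i]) : cabs (cnorm g) * cabs g <= 1.
Proof.
have := cabs_cnorm_sqr g; have := cabs_ge0 (cnorm g); have := cabs_ge0 g.
rewrite leNgt => h1 h2 h3; apply/negP => h.
have : 0 <= cabs (cnorm g) ^+ 2 by exact: sqr_ge0.
nra.
Qed.

(* Left multiplication of the column [(z^(k+1) p.2, p.1)] by the [k]-th NLFT
   factor, written [(z^k q.2, q.1)] with [q = layer g p]. *)
Definition layer (R : realType) (g : R[i]) (p : {poly R[i]} * {poly R[i]}) :=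
  (cnorm g *: (p.1 - g^* *: ('X * p.2)), cnorm g *: (g *: p.1 + 'X * p.2)).

Local Notation layers V s := (foldr (@layer _) V s).

Lemma layer0 (R : realType) (p : {poly R[i]} * {poly R[i]}) :
  layer 0 p = (p.1, 'X * p.2).
Proof.
have c1 : cnorm (0 : R[i]) = 1 by rewrite /cnorm normr0 expr0n addr0 sqrtC1 invr1.
by rewrite /layer c1 rmorph0 !scale1r !scale0r subr0 add0r.
Qed.

Lemma mkseq_cons (T : Type) (f : nat -> T) m :
  mkseq f m.+1 = f 0%N :: mkseq (fun i => f i.+1) m.
Proof. by rewrite /mkseq /= (iotaDl 1 0) -map_comp. Qed.

(** Only the second column [(b, a^* )] is needed, and left multiplication by a factor acts on it
    alone. Splitting off [z ^ k] keeps the recursion inside polynomials even for negative [k]. *)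
Lemma nlft_prod_col (R : realType) (z : R[i]) (m : nat) (k : int) (gam : int -> R[i]) :
  z != 0 ->
  let M := \prod_(i < m) nlft_factor (gam (k + i%:Z)) (k + i%:Z) z in
  let p := layers (1%R, 0%R) (mkseq (fun i => gam (k + i%:Z)) m) in
  M 0 1 = z ^ k * p.2.[z] /\ M 1 1 = p.1.[z].
Proof.
move=> z0; elim: m k => [|m IH] k M p.
  by rewrite /M /p big_ord0 /= !mxE hornerC mulr0 hornerC.
have [] := IH (k + 1).
rewrite /M /p big_ord_recl mkseq_cons /= addr0.
have e1 i : k + 1 + i%:Z = k + i.+1%:Z by rewrite -addrA -intS.
under eq_bigr do rewrite e1.
rewrite (eq_mkseq (g := fun i => gam (k + i.+1%:Z))); last by move=> i; rewrite e1.
set N := \prod_(i < m) _; set q := foldr _ _ _ => h1 h2.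
rewrite -!mulmxE !mxE !big_ord_recl !big_ord0 /=.
have -> : lift ord0 ord0 = 1 :> 'I_2 by apply/val_inj.
have -> : ord0 = 0 :> 'I_2 by apply/val_inj.
rewrite h1 h2 !mxE /= -/(cnorm (gam k)).
rewrite !(hornerZ, hornerD, hornerN, hornerM, hornerX) expfzDr // expr1z.
split; first by ring.
have zk : z ^ (- k) * z ^ k = 1 by rewrite -expfzDr // addNr expr0z.
transitivity (cnorm (gam k) * (q.1.[z] - (gam k)^* * (z * q.2.[z]) * (z ^ (- k) * z ^ k))).
  by ring.
by rewrite zk mulr1.
Qed.

Lemma poly_eq_of_horner_neq0 (R : realType) (p q : {poly R[i]}) :
  (forall z, z != 0 -> p.[z] = q.[z]) -> p = q.
Proof.
move=> H; apply/eqP; rewrite -subr_eq0; apply/eqP.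
apply: (@roots_geq_poly_eq0 _ _ [seq i.+1%:R | i <- iota 0 (size (p - q)%R)]).
- apply/allP => x /mapP[i _ ->]; rewrite /root !hornerE H ?subrr //.
  by rewrite pnatr_eq0.
- rewrite map_inj_uniq ?iota_uniq // => i j /eqP.
  by rewrite eqr_nat => /eqP [].
- by rewrite size_map size_iota.
Qed.

Lemma foldr_layer_coef0 (R : realType) V (s : seq R[i]) :
  (layers V s).1`_0 = (\prod_(g <- s) cnorm g) * V.1`_0.
Proof.
elim: s => [|g s IH]; first by rewrite big_nil mul1r.
by rewrite big_cons /= coefZ coefB coefZ coefXM eqxx mulr0 subr0 IH mulrA.
Qed.

Lemma prod_cnorm_neq0 (R : realType) (s : seq R[i]) : \prod_(g <- s) cnorm g != 0.
Proof.
elim: s => [|g s IH]; first by rewrite big_nil oner_eq0.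
by rewrite big_cons mulf_neq0 // cnorm_neq0.
Qed.

(** Used to show that entries at negative indices vanish. The constant coefficient of the second
    component is the first entry times a nonzero number, so divisibility by ['X] forces that entry
    to be [0]. *)
Lemma foldr_layer_strip (R : realType) m (B : {poly R[i]}) (s : seq R[i]) :
  (m <= size s)%N -> (layers (1%R, 0%R) s).2 = 'X^m * B ->
  layers (1%R, 0%R) (drop m s) = ((layers (1%R, 0%R) s).1, B).
Proof.
elim: m s => [|m IH] s.
  rewrite drop0 expr0 mul1r => _ <-; exact: surjective_pairing.
case: s => [//|g s] /= le_ms.
have := foldr_layer_coef0 (1, 0) s; set q := foldr _ _ s => q0 E.
have g0 : g = 0.
  have := congr1 (fun p : {poly R[i]} => p`_0) E.
  rewrite coefZ coefD coefZ !coefXM eqxx addr0 coefXnM /= => /eqP.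
  rewrite !mulf_eq0 (negbTE (cnorm_neq0 _)) /= q0 coef1 mulr1.
  by rewrite (negbTE (prod_cnorm_neq0 _)) orbF => /eqP.
move: E; have := layer0 q; rewrite /layer g0 => -[-> ->].
rewrite exprS -mulrA => /(mulfI (negbT (polyX_eq0 _))) E.
exact: IH.
Qed.

Lemma size_foldr_layer (R : realType) (s : seq R[i]) :
  (size (layers (1%R, 0%R) s).1 <= maxn 1 (size s))%N /\
  (size (layers (1%R, 0%R) s).2 <= size s)%N.
Proof.
elim: s => [|g s [IH1 IH2]]; first by rewrite /= size_poly1 size_poly0.
have hX : (size ('X * (layers (1%R, 0%R) s).2)%R <= (size s).+1)%N.
  by rewrite mulrC (leq_trans (size_polyMleq _ _)) // size_polyX addn2.
have h1 : (size (layers (1%R, 0%R) s).1 <= (size s).+1)%N by lia.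
rewrite /= (_ : maxn 1 (size s).+1 = (size s).+1); last by lia.
split; apply: leq_trans (size_scale_leq _ _) _; apply: leq_trans (size_polyD _ _) _;
  rewrite geq_max ?size_polyN ?h1 ?hX /= ?andbT;
  by apply: leq_trans (size_scale_leq _ _) _.
Qed.

(** The counterpart at the other end: the top coefficient detects the last entry, so a degree bound
    on [B] kills trailing entries. *)
Lemma foldr_layer_rcons_coef (R : realType) (s : seq R[i]) (g : R[i]) :
  (layers (1%R, 0%R) (rcons s g)).2`_(size s) =
  g * \prod_(h <- rcons s g) cnorm h.
Proof.
elim: s => [|h s IH] /=.
  by rewrite big_seq1 mulr0 addr0 coefZ coefZ coef1 mulr1 mulrC.
rewrite big_cons coefZ coefD coefZ coefXM /= IH nth_default ?mulr0 ?add0r; last first.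
  by apply: leq_trans (proj1 (size_foldr_layer _)) _; rewrite size_rcons; lia.
by rewrite mulrCA.
Qed.

Lemma foldr_layer_truncate (R : realType) (f : nat -> R[i]) n m :
  (size (layers (1%R, 0%R) (mkseq f (n + m))).2 <= n)%N ->
  layers (1%R, 0%R) (mkseq f (n + m)) = layers (1%R, 0%R) (mkseq f n).
Proof.
elim: m => [|m IH]; first by rewrite addn0.
rewrite addnS mkseqS => H.
have f0 : f (n + m)%N = 0.
  have := foldr_layer_rcons_coef (mkseq f (n + m)) (f (n + m)%N).
  rewrite nth_default; last by rewrite size_mkseq (leq_trans H) ?leq_addr.
  by move/esym/eqP; rewrite mulf_eq0 (negbTE (prod_cnorm_neq0 _)) orbF => /eqP.
move: H; rewrite f0 foldr_rcons layer0 mulr0; exact: IH.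
Qed.

Lemma nlft_eq_foldr_layer (R : realType) n N (gam : int -> R[i]) (A B : {poly R[i]}) :
  (size B <= n)%N ->
  (forall k : int, (N < `|k|)%N -> gam k = 0) ->
  (forall z : R[i], z != 0 ->
     nlft N gam z = mx2 (star A z) B.[z] (- star B z) A.[z]) ->
  layers (1%R, 0%R) (mkseq (fun i => gam i%:Z) n) = (A, B).
Proof.
move=> sB supp HN; pose s := mkseq (fun i => gam (- N%:Z + i%:Z)) (N + N).+1.
have Hs z : z != 0 -> z ^ (- N%:Z) * (layers (1%R, 0%R) s).2.[z] = B.[z] /\
    (layers (1%R, 0%R) s).1.[z] = A.[z].
  move=> z0; have [h1 h2] := nlft_prod_col (N + N).+1 (- N%:Z) gam z0.
  have := HN z z0; rewrite /nlft big_mkcond /=.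
  rewrite (_ : \prod_(i < _) _ =
    \prod_(i < (N + N).+1) nlft_factor (gam (- N%:Z + i%:Z)) (- N%:Z + i%:Z) z).
    by move=> E; rewrite -h1 -h2 E !mxE.
  apply: eq_bigr => i _; rewrite (addrC (- _)); case: eqP => //= ->.
  rewrite /nlft_factor -/(cnorm 0) /cnorm normr0 expr0n addr0 sqrtC1 invr1 scale1r.
  rewrite rmorph0 !mul0r oppr0.
  by apply/matrixP => a b; rewrite !mxE; move: a b; do 2![case=> [] [|[|?]] ?].

have E1 : (layers (1%R, 0%R) s).1 = A.
  by apply: poly_eq_of_horner_neq0 => z /Hs[].
have E2 : (layers (1%R, 0%R) s).2 = 'X^N * B.
  apply: poly_eq_of_horner_neq0 => z z0; have [h _] := Hs z z0.
  by rewrite hornerM hornerXn -h mulrA -exprnN mulfV ?mul1r // expf_neq0.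
have := foldr_layer_strip (m := N) _ E2; rewrite size_mkseq E1 => /(_ ltac:(lia)).
have -> : drop N s = mkseq (fun i => gam i%:Z) N.+1.
  rewrite /s /mkseq -map_drop drop_iota add0n -addnS addKn.
  rewrite -[N in iota N]addn0 iotaDl -map_comp; apply: eq_map => i /=.
  by rewrite PoszD addKr.
move=> E.
(* [n] may be smaller or larger than [N.+1], so the sequence is first padded by zeros to length
   [N.+1 + n] and then cut to [n]. *)
have pad m : layers (1%R, 0%R) (mkseq (fun i => gam i%:Z) (N.+1 + m)) = (A, B).
  elim: m => [|m IH]; first by rewrite addn0.
  rewrite addnS mkseqS supp; last by rewrite absz_nat; lia.
  by rewrite foldr_rcons layer0 mulr0.
rewrite -(@foldr_layer_truncate R _ n N.+1) addnC pad //.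
Qed.

(** * Perturbation of the normal equations *)

Lemma sum_adjoint (R : realType) k (F : nat -> nat -> R[i]) (u r : nat -> R[i]) :
  \sum_(j < k) (u j)^* * (\sum_(i < k) (F i j)^* * r i) =
  \sum_(i < k) (\sum_(j < k) F i j * u j)^* * r i.
Proof.
under eq_bigr do rewrite mulr_sumr.
rewrite exchange_big /=; apply: eq_bigr => i _.
rewrite rmorph_sum mulr_suml; apply: eq_bigr => j _.
by rewrite rmorphM /=; ring.
Qed.

Lemma l2norm_sqrC (R : realType) k (u : nat -> R[i]) :
  (l2norm k u ^+ 2)%:C%C = \sum_(i < k) (u i)^* * u i.
Proof.
by rewrite l2norm_sqr rmorph_sum; apply: eq_bigr => i _; rewrite /= cabs_sqr mulrC.
Qed.

Lemma l2norm_conj (R : realType) k (u : nat -> R[i]) :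
  l2norm k (fun i => (u i)^*) = l2norm k u.
Proof. by rewrite /l2norm; under eq_bigr do rewrite cabs_conj. Qed.

Definition normal_equation (R : realType) k (F : nat -> nat -> R[i]) (y : nat -> R[i]) :=
  forall j, (j < k)%N ->
  y j + \sum_(i < k) (F i j)^* * (\sum_(l < k) F i l * y l) = (j == 0%N)%:R.

(** Pairing the equation with [y] gives [|y|^2 + |F y|^2 = conj y_0], which is at most [|y|]. *)
Lemma normal_equation_le1 (R : realType) k F (y : nat -> R[i]) :
  normal_equation k F y ->
  l2norm k y <= 1 /\ l2norm k (fun i => \sum_(l < k) F i l * y l) <= 1.
Proof.
case: k => [|k] H; first by rewrite /l2norm !big_ord0 sqrtr0.
set z := fun i => \sum_(l < k.+1) F i l * y l.
have E : (l2norm k.+1 y ^+ 2 + l2norm k.+1 z ^+ 2)%:C%C = (y 0%N)^*.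
  rewrite rmorphD /= !l2norm_sqrC -(sum_adjoint k.+1 F y z) -big_split /=.
  rewrite (eq_bigr (fun j : 'I_k.+1 => (y j)^* * (val j == 0%N)%:R)); last first.
    by move=> j _; rewrite -mulrDr H.
  rewrite big_ord_recl /= mulr1 big1 ?addr0 // => j _.
  by rewrite mulr0.
have := cabs_le_l2norm y (ltn0Sn k); rewrite -cabs_conj -E cabs_real; last first.
  by rewrite addr_ge0 // sqr_ge0.
have := l2norm_ge0 k.+1 y; have := l2norm_ge0 k.+1 z.
set Y := l2norm _ y; set Z := l2norm _ z.
clear => Z0 Y0 h; have h2 := sqr_ge0 (2 * Y - 1); have h3 := sqr_ge0 Z.
by split; rewrite leNgt; apply/negP => h'; nra.
Qed.

(** Subtract the equations and pair with [h = y' - y]: [|h|^2 + |F' h|^2] is at most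
    [|F' h| |(F' - F) y| + |(F' - F) h| |F y|], hence at most [D (|F' h| + |h|)] by the bounds by
    [1]. So [|h| + |F' h| <= 2 D], and the norms of [F] and [F'] never enter. *)
Lemma normal_equation_perturb (R : realType) k F F' (y y' : nat -> R[i]) (D : R) :
  0 <= D -> normal_equation k F y -> normal_equation k F' y' ->
  (forall v : nat -> R[i],
     l2norm k (fun i => \sum_(l < k) (F' i l - F i l) * v l) <= D * l2norm k v) ->
  l2norm k (fun i => y' i - y i) <= 2 * D.
Proof.
move=> D0 H H' HD.
have [y1 z1] := normal_equation_le1 H.
set z := (fun i => \sum_(l < k) F i l * y l) in z1.
have [h Eh] : exists h : nat -> R[i], forall i, h i = y' i - y i.
  by exists (fun i => y' i - y i).
pose q i := \sum_(l < k) F' i l * h l.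
pose e i := \sum_(l < k) (F' i l - F i l) * y l.
pose t i := \sum_(l < k) (F' i l - F i l) * h l.
pose w i := q i + e i + z i.
have Ez i : \sum_(l < k) F' i l * y' l = w i.
  by rewrite /w -!big_split /=; apply: eq_bigr => l _; rewrite Eh; ring.
have Et i : \sum_(l < k) F i l * h l = q i - t i.
  by rewrite -sumrB; apply: eq_bigr => l _; ring.
have E : (l2norm k h ^+ 2 + l2norm k q ^+ 2)%:C%C =
    - (\sum_(i < k) (q i)^* * e i + \sum_(i < k) (t i)^* * z i).
  have : \sum_(j < k) (h j)^* * (h j +
     (\sum_(i < k) (F' i j)^* * w i - \sum_(i < k) (F i j)^* * z i)) = 0.
    rewrite big1 // => j _; have := H' j (ltn_ord j); have := H j (ltn_ord j).
    rewrite [X in _ -> _ + X = _ -> _](eq_bigr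
      (fun i : 'I_k => (F' i j)^* * w i)); last by move=> i _; rewrite Ez.
    rewrite -/z => e1 e2; rewrite [X in _ * X](_ : _ = 0) ?mulr0 //.
    move: e1 e2; set S := \sum_(i < k) _ => e1; set S' := \sum_(i < k) _ => e2.
    by rewrite Eh -[RHS](subrr (y j + S)) {1}e1 -e2; ring.
  under eq_bigr do rewrite mulrDr mulrBr.
  rewrite big_split sumrB /= (sum_adjoint k F' h w).
  rewrite (sum_adjoint k F h z) -l2norm_sqrC -/(q _) rmorphD /= => /eqP.
  rewrite addr_eq0 => /eqP ->; rewrite (l2norm_sqrC k q) opprB.
  rewrite -sumrB -!big_split /= -sumrN; apply: eq_bigr => i _.
  by rewrite Et -/(q i) rmorphB /w /=; ring.
have := congr1 (@cabs R) E; rewrite cabsN cabs_real; last first.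
  by rewrite addr_ge0 // sqr_ge0.
have c1 := l2norm_CauchySchwarz k (fun i => (q i)^*) e.
have c2 := l2norm_CauchySchwarz k (fun i => (t i)^*) z.
move: c1 c2 (cabsD (\sum_(i < k) (q i)^* * e i) (\sum_(i < k) (t i)^* * z i)).
rewrite !l2norm_conj => c1 c2 c3 E'.
have ey := HD y; have th := HD h.
rewrite (@eq_l2norm R k _ h) => [|i _]; last by rewrite Eh.
move: (l2norm_ge0 k h) (l2norm_ge0 k q) (l2norm_ge0 k y) (l2norm_ge0 k z)
  (l2norm_ge0 k e) (l2norm_ge0 k t) ey th z1 y1 c1 c2 c3 E'.
rewrite -/e -/t.
move: (l2norm k h) (l2norm k q) (l2norm k y) (l2norm k z) (l2norm k e) (l2norm k t).
move=> a b c d f g.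
move: (cabs _) (cabs _) (cabs _) => x1 x2 x3.
clear -D0 => a0 b0 c0 d0 f0 g0 ey th d1 c1 h1 h2 h3 E.
have f1 : f <= D by apply: le_trans ey _; rewrite -[leRHS]mulr1 ler_wpM2l.
have h4 : b * f <= b * D by rewrite ler_wpM2l.
have h5 : g * d <= D * a by apply: le_trans th; rewrite -[leRHS]mulr1 ler_wpM2l.
rewrite leNgt; apply/negP => lt; have : 0 <= (a - b) ^+ 2 by exact: sqr_ge0.
have : 0 <= (a + b - 2 * D) * (a + b) by rewrite mulr_ge0 //; lra.
have : 0 < (a - 2 * D) * a by rewrite mulr_gt0 //; lra.
by nra.
Qed.

(** * The exact output in terms of the quotient *)

(* [(U, W)] is, up to normalisation, the NLFT of the first [k] entries of [s], and
   [Ur], [Wr] are the reversals [z^k U^*], [z^k W^*]; undoing these [k] layers sends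
   [(a, b)] to a multiple of [layers V (drop k s)]. *)
Lemma layers_undo (R : realType) (V : {poly R[i]} * {poly R[i]}) (s : seq R[i])
    (a b : {poly R[i]}) k :
  layers V s = (a, b) -> (k <= size s)%N ->
  exists (U W Ur Wr : {poly R[i]}) (lam : R[i]) (x : R),
  [/\ [/\ (size U <= maxn 1 k)%N, (size W <= k)%N, (size Ur <= k.+1)%N
        & (size Wr <= k.+1)%N],
      forall j, (j <= k)%N -> Ur`_(k - j) = (U`_j)^* /\ Wr`_(k - j) = (W`_j)^*,
      U * b - W * a = lam *: ('X^k * (layers V (drop k s)).2) /\
      Ur * a + Wr * b = lam *: ('X^k * (layers V (drop k s)).1)
    & 0 < x /\ lam * (layers V (drop k s)).1`_0 = x%:C%C * a`_0].
Proof.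
move=> Eab; elim: k => [|k IH] lek.
  exists 1, 0, 1, 0, 1, 1; split.
  - by rewrite size_poly1 size_poly0.
  - by case=> // _; rewrite subn0 coef1 coef0 /= conjC1 conjC0.
  - by rewrite drop0 Eab /= !mul1r !mul0r subr0 addr0 !scale1r.
  - by rewrite drop0 Eab /= ltr01 rmorph1.
have [U [W [Ur [Wr [lam [x [[sU sW sUr sWr] Hrev [HP HS] [x0 Hx]]]]]]]] := IH (ltnW lek).
move: HP HS Hx; rewrite (drop_nth 0 lek) /=; set g := nth 0 s k.
set q := layers V (drop k.+1 s) => HP HS Hx.
(* The adjugate of the next layer applied to the previous combination; the factor ['X] accounts for
   the degree of the reversals growing by one. *)
exists (U - g *: Wr), (W + g *: Ur), ('X * (Ur - g^* *: W)), ('X * (Wr + g^* *: U)).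
(* Thus [x] is the product of [1 + |g_j|^2] over the undone layers; that it is real and positive
   lets it survive conjugation and be divided out. *)
exists (lam * cnorm g * (1 + g * g^*)), ((1 + cabs g ^+ 2) * x).
have szD (p r : {poly R[i]}) (c : R[i]) m :
    (size p <= m)%N -> (size r <= m)%N -> (size (p + c *: r)%R <= m)%N.
  move=> sp sr; apply: leq_trans (size_polyD _ _) _; rewrite geq_max sp /=.
  exact: leq_trans (size_scale_leq _ _) sr.
have szX (p : {poly R[i]}) m : (size p <= m)%N -> (size ('X * p)%R <= m.+1)%N.
  by move=> sp; rewrite mulrC (leq_trans (size_polyMleq _ _)) // size_polyX addn2.
have sU' : (size U <= k.+1)%N by lia.
have sW' : (size W <= k.+1)%N by lia.
split.
- split.
  + by rewrite -scaleNr; apply: leq_trans (szD _ _ _ k.+1 _ _) _ => //; lia.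
  + exact: szD.
  + by apply: szX; rewrite -scaleNr; exact: szD.
  + by apply: szX; exact: szD.
- move=> j; rewrite leq_eqVlt => /orP[/eqP->|].
    have U0 : U`_k.+1 = 0 by rewrite nth_default.
    have W0 : W`_k.+1 = 0 by rewrite nth_default.
    have Ur0 : Ur`_k.+1 = 0 by rewrite nth_default.
    have Wr0 : Wr`_k.+1 = 0 by rewrite nth_default.
    rewrite subnn !coefXM eqxx coefB coefD !coefZ U0 W0 Ur0 Wr0.
    by rewrite !mulr0 subr0 addr0 rmorph0.
  rewrite ltnS => lejk; rewrite subSn // !coefXM /= !coefB !coefD !coefZ.
  have [-> ->] := Hrev j lejk.
  have [] := Hrev (k - j)%N (leq_subr _ _); rewrite subKn // => e1 e2.
  rewrite e1 e2 rmorphB rmorphD /= !rmorphM /= !conjCK; by split.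
- split.
    transitivity ((U * b - W * a) - g *: (Ur * a + Wr * b)).
      by rewrite -!mul_polyC; ring.
    rewrite HP HS exprS -!mul_polyC !(polyCM, polyCD); ring.
  transitivity ('X * ((Ur * a + Wr * b) + g^* *: (U * b - W * a))).
    by rewrite -!mul_polyC; ring.
  rewrite HP HS exprS -!mul_polyC !(polyCM, polyCD); ring.
- split; first by rewrite mulr_gt0 // ltr_pwDl ?sqr_ge0.
  move: Hx; rewrite coefZ coefB coefZ coefXM eqxx mulr0 subr0 => Hx.
  rewrite rmorphM rmorphD /= cabs_sqr rmorph1 -[RHS]mulrA -Hx; ring.
Qed.

Lemma coef_mul_unit (R : realType) n (p e : {poly R[i]}) j :
  (forall i, (i < n)%N -> e`_i = (i == 0%N)%:R) -> (j < n)%N -> (p * e)`_j = p`_j.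
Proof.
move=> He ltj; rewrite coefMr big_ord_recl /= subn0 He ?mulr1 ?(leq_ltn_trans _ ltj) //.
rewrite big1 ?addr0 // => i _; rewrite He ?mulr0 //.
by rewrite (leq_ltn_trans _ ltj) // lift0 ltn_ord.
Qed.

Definition toeplitz (R : realType) (f : {poly R[i]}) (i j : nat) : R[i] :=
  if (j <= i)%N then f`_(i - j) else 0.

Lemma sum_toeplitz (R : realType) k (f p : {poly R[i]}) i :
  (i < k)%N -> \sum_(l < k) toeplitz f i l * p`_l = (p * f)`_i.
Proof.
move=> lti; rewrite coefM (big_ord_widen k (fun l => p`_l * f`_(i - l))) //.
rewrite [RHS]big_mkcond; apply: eq_bigr => l _; rewrite /toeplitz ltnS.
by case: leqP => _; rewrite ?mul0r // mulrC.
Qed.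

(** The case [k = 0] stands apart: there [U = 1] has a coefficient at index [k], which vanishes for
    [k > 0]. *)
Lemma layers_gamma0 (R : realType) (V : {poly R[i]} * {poly R[i]}) (s : seq R[i])
    (a b v : {poly R[i]}) :
  layers V s = (a, b) -> (0 < size s)%N -> (v * a)`_0 = 1 -> nth 0 s 0 = (v * b)`_0.
Proof.
case: s => [//|g s] /= Eab _; rewrite !coef0M => va.
case: Eab => Ea Eb; move: va; rewrite -Ea -Eb !coefZ coefB coefD !coefZ !coefXM eqxx.
rewrite mulr0 subr0 addr0 => va; rewrite -[LHS]mulr1 -va; ring.
Qed.

(** Multiplying the identities of [layers_undo] by [v], with [f = v * b], gives mod [z^(k+1)] that
    [U f - W = g x z^k] and [Ur + Wr f = x z^k]. Below degree [k] the first says [W = T U]; the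
    second, reversed and conjugated, says [U + T^* W = x e_0]. Hence [y = U / x], and degree [k] of
    the first identity gives [g]. *)
Lemma layers_gamma (R : realType) (V : {poly R[i]} * {poly R[i]}) (s : seq R[i])
    (a b v : {poly R[i]}) k :
  layers V s = (a, b) ->
  (forall j, (j < size s)%N -> (v * a)`_j = (j == 0%N)%:R) ->
  (0 < k < size s)%N ->
  exists y : nat -> R[i],
    normal_equation k (toeplitz (v * b)) y /\
    nth 0 s k = \sum_(j < k) y j * (v * b)`_(k - j).
Proof.
move=> Eab Hv /andP[k0 ltk].
have [U [W [Ur [Wr [lam [x [[sU sW sUr sWr] Hrev [HP HS] [x0 Hx]]]]]]]] :=
  layers_undo Eab (ltnW ltk).
set f := v * b; set g := nth 0 s k.
have xC0 : x%:C%C != 0 :> R[i] by rewrite eq_complex /= gt_eqF.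
have va0 : v`_0 * a`_0 = 1 by rewrite -coef0M Hv // (leq_ltn_trans _ ltk).
have kk (p : {poly R[i]}) j : (j <= k)%N ->
    (lam *: ('X^k * p) * v)`_j = if (j < k)%N then 0 else lam * p`_0 * v`_0.
  move=> lejk; rewrite -scalerAl -[_ * p * v]mulrA coefZ coefXnM; case: ltnP => lekj.
    by rewrite mulr0.
  by have -> : j = k; [apply/eqP; rewrite eqn_leq lejk|rewrite subnn coef0M mulrA].
have va (p : {poly R[i]}) j : (j <= k)%N -> (p * (v * a))`_j = p`_j.
  by move=> lejk; apply: (coef_mul_unit p Hv); exact: leq_ltn_trans ltk.
have EP j : (j <= k)%N -> (U * f)`_j - W`_j = if (j < k)%N then 0 else g * x%:C%C.
  move=> lejk; rewrite -(va W j lejk) -coefB.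
  have -> : U * f - W * (v * a) = (U * b - W * a) * v by rewrite /f; ring.
  rewrite HP kk //; case: ifP => // _.
  have -> : (layers V (drop k s)).2`_0 = g * (layers V (drop k s)).1`_0.
    rewrite (drop_nth 0 ltk) /= !coefZ coefB coefD !coefZ !coefXM eqxx.
    by rewrite mulr0 subr0 addr0 -/g; ring.
  by rewrite mulrCA Hx -!mulrA [a`_0 * _]mulrC va0 mulr1.
have ES j : (j <= k)%N -> Ur`_j + (Wr * f)`_j = if (j < k)%N then 0 else x%:C%C.
  move=> lejk; rewrite -(va Ur j lejk) -coefD.
  have -> : Ur * (v * a) + Wr * f = (Ur * a + Wr * b) * v by rewrite /f; ring.
  rewrite HS kk //; case: ifP => // _.
  by rewrite Hx -mulrA [a`_0 * _]mulrC va0 mulr1.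
have Wk : W`_k = 0 by rewrite nth_default.
have Uk : U`_k = 0 by rewrite nth_default // (leq_trans sU) // geq_max k0 leqnn.
exists (fun j => U`_j / x%:C%C); split; last first.
  have := EP k (leqnn k); rewrite ltnn Wk subr0 => E.
  rewrite -[g](mulfK xC0) -E coefM big_ord_recr /= Uk mul0r addr0 mulr_suml.
  by apply: eq_bigr => j _; ring.
move=> j ltj.
have Ez i : (i < k)%N -> \sum_(l < k) toeplitz f i l * (U`_l / x%:C%C) = W`_i / x%:C%C.
  move=> lti; under eq_bigr do rewrite mulrA.
  rewrite -mulr_suml (sum_toeplitz f U lti).
  have := EP i (ltnW lti); rewrite lti => /eqP; rewrite subr_eq0 => /eqP ->//.
rewrite (eq_bigr (fun i : 'I_k => (toeplitz f i j)^* * W`_i / x%:C%C)); last first.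
  by move=> i _; rewrite Ez // mulrA.
rewrite -mulr_suml -mulrDl; apply: (mulIf xC0); rewrite divfK //.
have lejk := ltnW ltj.
have := ES (k - j)%N (leq_subr _ _); rewrite (proj1 (Hrev j lejk)) coefMr big_ord_recr /=.
rewrite subnn (_ : Wr`_0 = 0) ?mul0r ?addr0; last first.
  by have := proj2 (Hrev k (leqnn k)); rewrite subnn Wk rmorph0.
move/(congr1 Num.conj); rewrite rmorphD /= conjCK rmorph_sum /=.
rewrite -(big_mkord xpredT (fun i => (toeplitz f i j)^* * W`_i)).
rewrite (@big_cat_nat _ _ _ j) //= [X in _ -> _ + (X + _) = _]big_nat_cond.
rewrite [X in _ -> _ + (X + _) = _]big1 ?add0r; last first.
  by move=> i /andP[/andP[_ ltij] _]; rewrite /toeplitz leqNgt ltij rmorph0 mul0r.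
rewrite (_ : \sum_(j <= i < k) _ = \sum_(i < k - j) (toeplitz f (i + j) j)^* * W`_(i + j));
  last by rewrite -{1}[j]add0n big_addn big_mkord.
move=> E.
transitivity ((if (k - j < k)%N then 0 else x%:C%C)^*).
  rewrite -E; congr (_ + _); apply: eq_bigr => l _.
  rewrite /toeplitz leq_addl addnK rmorphM /= mulrC.
  have lt1 : (j + l <= k)%N by have := ltn_ord l; lia.
  by rewrite -subnDA (proj2 (Hrev _ lt1)) conjCK addnC.
(* Reversal sends degree [k], the only one with a nonzero value, to index [0]: this is the
   right-hand side [e_0]. *)
have -> : (k - j < k)%N = (j != 0%N) by apply/idP/idP; lia.
have xr : (x%:C%C)^* = x%:C%C :> R[i] by exact: conjc_real.
by case: eqP => _ /=; rewrite ?mul1r ?mul0r ?conjC0.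
Qed.

(** * Backward error *)

Lemma cnorm_opp (R : realType) (g : R[i]) : cnorm (- g) = cnorm g.
Proof. by rewrite /cnorm normrN. Qed.

Lemma cabs_rotation (R : realType) (g a b : R[i]) :
  cabs (cnorm g * (a + g^* * b)) ^+ 2 + cabs (cnorm g * (b - g * a)) ^+ 2 =
  cabs a ^+ 2 + cabs b ^+ 2.
Proof.
apply: (@complexI R); rewrite !rmorphD /= !cabs_sqr.
rewrite !rmorphM !rmorphB !rmorphD !rmorphM /= conj_cnorm conjCK.
transitivity (cnorm g ^+ 2 * (1 + g * g^*) * (a * a^* + b * b^*)); first by ring.
by rewrite cnorm_sqr mul1r.
Qed.

Lemma l2norm_rotation (R : realType) n (g : R[i]) (a b : nat -> R[i]) :
  l2norm n (fun j => cnorm g * (a j + g^* * b j)) ^+ 2 +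
  l2norm n (fun j => cnorm g * (b j - g * a j)) ^+ 2 =
  l2norm n a ^+ 2 + l2norm n b ^+ 2.
Proof.
rewrite !l2norm_sqr -!big_split /=; apply: eq_bigr => j _; exact: cabs_rotation.
Qed.

(** The triangle inequality in the plane, with the norm of [(r, s)] bounded by [r + s]. *)
Lemma sqr_pair_add (R : realType) (p q r s y : R) :
  0 <= p -> 0 <= q -> 0 <= r -> 0 <= s -> 0 <= y -> p ^+ 2 + q ^+ 2 <= y ^+ 2 ->
  (p + r) ^+ 2 + (q + s) ^+ 2 <= (y + (r + s)) ^+ 2.
Proof.
move=> p0 q0 r0 s0 y0 h.
have py : p <= y by rewrite -ler_sqr ?nnegrE //; have := sqr_ge0 q; lra.
have qy : q <= y by rewrite -ler_sqr ?nnegrE //; have := sqr_ge0 p; lra.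
have := ler_wpM2r r0 py; have := ler_wpM2r s0 qy; have := mulr_ge0 r0 s0.
have := mulr_ge0 r0 y0; have := mulr_ge0 s0 y0; nra.
Qed.

Lemma l2norm_size (R : realType) n (p : {poly R[i]}) :
  (size p <= n)%N -> l2norm n.+1 (fun j => p`_j) = l2norm n (fun j => p`_j).
Proof.
by move=> sp; rewrite /l2norm big_ord_recr /= nth_default // cabs0 expr0n addr0.
Qed.

Lemma be_bound_arith (R : realType) (eps H b' b a r v b0 kk nn : R) :
  b <= (1 + 8 * kk * eps) * (b0 + 4 * kk * H) -> b' <= v + r ->
  r <= 4 * eps * (b + H * a) -> v <= b + H * a -> kk * eps <= nn * eps ->
  0 <= kk * eps -> 32 * eps <= 1 -> H * a <= H * 2 -> 0 <= b0 -> 0 <= kk * H ->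
  32 * nn * eps <= 1 -> 0 <= eps -> 0 <= H ->
  b' <= (1 + 8 * (kk + 1) * eps) * (b0 + 4 * (kk + 1) * H).
Proof.
move=> IH h1 e1 h2 ke ke0 eps1 hha b00 kH neps eps0 H0.
have h3 : b' <= (1 + 4 * eps) * b + 4 * H.
  have : 4 * eps * (H * a) <= 4 * eps * (H * 2) by rewrite ler_wpM2l // mulr_ge0.
  have : H * (32 * eps) <= H * 1 by rewrite ler_wpM2l.
  lra.
have S0 : 0 <= b0 + 4 * kk * H by lra.
have h4 : (1 + 4 * eps) * b <= (1 + 8 * (kk + 1) * eps) * (b0 + 4 * kk * H).
  apply: (@le_trans _ _ ((1 + 4 * eps) * ((1 + 8 * kk * eps) * (b0 + 4 * kk * H)))).
    by rewrite ler_wpM2l //; lra.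
  rewrite mulrA ler_wpM2r //.
  have : eps * (kk * eps) <= eps * (1 / 32) by rewrite ler_wpM2l //; lra.
  lra.
have : 0 <= 8 * (kk + 1) * eps * H by rewrite mulr_ge0 //; lra.
lra.
Qed.

(** Arithmetic of the inductive step of [pull_back_bounds]: [x], [y] are the deviations at step
    [k + 1], [r], [s] the rounding errors of step [k], [eb] the new deviation of [b]. As
    [a, b <= 2], [r + s <= 32 eps], whence [32]. The increment of [eb] is at most
    [8 eps b0 + 88 eps nn H], which [104] covers. *)
Lemma pull_back_arith (R : realType)
    (eps H kk mm nn x y r s a b b0 eb da db : R) :
  32 * nn * eps <= 1 -> 0 <= eps -> 0 <= H -> 1 <= nn ->
  x ^+ 2 + y ^+ 2 <= (32 * mm * eps) ^+ 2 ->
  y <= 104 * mm * eps * (b0 + nn * H) ->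
  da <= x + r -> db <= y + s -> eb <= db + H * da -> a <= 2 -> b <= 2 ->
  b <= (1 + 8 * kk * eps) * (b0 + 4 * kk * H) ->
  s <= 4 * eps * (a + b) -> r <= 4 * eps * (a + b) -> s <= 4 * eps * (b + H * a) ->
  0 <= r -> 0 <= s -> 0 <= x -> 0 <= y -> 0 <= da -> 0 <= db -> 0 <= b0 ->
  kk <= nn -> mm <= nn -> 0 <= kk -> 0 <= mm ->
  da ^+ 2 + db ^+ 2 <= (32 * (mm + 1) * eps) ^+ 2 /\
  eb <= 104 * (mm + 1) * eps * (b0 + nn * H).
Proof.
move=> neps eps0 H0 n1 IH1 IH2 da_le db_le eb_le a2 b2 bk e1 e2 e3 r0 s0 x0 y0 da0 db0
  b00 k1 m1 k0 m0.
have e4 : 0 <= 4 * eps by rewrite mulr_ge0.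
have me0 : 0 <= mm * eps by rewrite mulr_ge0.
have me : mm * eps <= nn * eps by rewrite ler_wpM2r.
have ke : kk * eps <= nn * eps by rewrite ler_wpM2r.
have h5 : 4 * eps * (a + b) <= 4 * eps * 4 by rewrite ler_wpM2l //; lra.
have Y0 : 0 <= 32 * mm * eps by lra.
split.
  have h2 := sqr_pair_add x0 y0 r0 s0 Y0 IH1.
  have h3 : da ^+ 2 <= (x + r) ^+ 2 by rewrite ler_sqr ?nnegrE ?addr_ge0.
  have h4 : db ^+ 2 <= (y + s) ^+ 2 by rewrite ler_sqr ?nnegrE ?addr_ge0.
  apply: le_trans (lerD h3 h4) (le_trans h2 _).
  by rewrite ler_sqr ?nnegrE ?addr_ge0 //; lra.
have xY : x <= 32 * mm * eps.
  by rewrite -ler_sqr ?nnegrE //; have := sqr_ge0 y; lra.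
have nH : 0 <= nn * H by rewrite mulr_ge0 //; lra.
have kH : kk * H <= nn * H by rewrite ler_wpM2r.
have bk' : b <= 2 * (b0 + 4 * (nn * H)).
  have kH0 : 0 <= kk * H by rewrite mulr_ge0.
  have ke0 : 0 <= kk * eps by rewrite mulr_ge0.
  by apply: le_trans bk _; apply: ler_pM; lra.
have h6 : 4 * eps * (b + H * a) <= 4 * eps * (2 * (b0 + 4 * (nn * H)) + H * 2).
  by apply: ler_wpM2l => //; apply: lerD => //; apply: ler_wpM2l.
have ne1 : eps <= nn * eps by rewrite ler_peMl.
have ne0 : 0 <= nn * eps by lra.
have h7 : H * da <= H * (48 * (nn * eps)) by rewrite ler_wpM2l //; lra.
have h8 : eps * H <= eps * (nn * H) by rewrite ler_wpM2l // ler_peMl.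
have h9 : 0 <= eps * b0 by rewrite mulr_ge0.
apply: le_trans eb_le _; apply: le_trans (lerD db_le h7) _.
have h10 : 0 <= eps * (nn * H) by rewrite mulr_ge0.
move: IH2 e3 h6 h8 h9 h10; clear; lra.
Qed.

Section BackwardError.

Variables (R : realType) (n : nat) (ah bh : nat -> {poly R[i]}) (g : nat -> R[i]).
Variables (eps H : R).
Hypothesis eps0 : 0 <= eps.
Hypothesis neps : 32 * n%:R * eps <= 1.
Hypothesis n0 : (0 < n)%N.
Hypothesis sa : forall k, (size (ah k) <= n)%N.
Hypothesis sb : forall k, (size (bh k) <= n)%N.
Hypothesis ab1 :
  l2norm n (fun j => (ah 0)`_j) ^+ 2 + l2norm n (fun j => (bh 0)`_j) ^+ 2 <= 1.
Hypothesis gH : forall k, (k < n)%N -> cabs (g k) <= H.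

(** Errors are measured against the exact rotation with the computed [g k], so the rotation itself
    stays unitary. Since [berr] uses ['X * bh k.+1], its entry [0] records what is lost by
    discarding the first entry of [b]. *)
Let aerr k j := (ah k.+1)`_j - cnorm (g k) * ((ah k)`_j + (g k)^* * (bh k)`_j).
Let berr k j := ('X * bh k.+1)`_j - cnorm (g k) * ((bh k)`_j - g k * (ah k)`_j).

Hypothesis aerr_le : forall k j, (k < n)%N ->
  cabs (aerr k j) <=
  4 * eps * cabs (cnorm (g k)) * (cabs (ah k)`_j + cabs (g k) * cabs (bh k)`_j).
Hypothesis berr_le : forall k j, (k < n)%N ->
  cabs (berr k j) <=
  4 * eps * cabs (cnorm (g k)) * (cabs (bh k)`_j + cabs (g k) * cabs (ah k)`_j).

(** Length [n.+1] keeps the shift ['X * bh k.+1] untruncated, hence isometric. *)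
Local Notation nrm v := (l2norm n.+1 v).
Local Notation al k := (nrm (fun j => (ah k)`_j)).
Local Notation be k := (nrm (fun j => (bh k)`_j)).

Let e4 : 0 <= 4 * eps. Proof. by rewrite mulr_ge0. Qed.

Let n1 : 1 <= n%:R :> R. Proof. by rewrite ler1n. Qed.

Let H0 : 0 <= H. Proof. exact: le_trans (cabs_ge0 _) (gH n0). Qed.

Lemma nrm_aerr k : (k < n)%N -> nrm (aerr k) <= 4 * eps * (al k + be k).
Proof.
move=> ltk; set c := cabs (cnorm (g k)).
have c0 : 0 <= c by exact: cabs_ge0.
have h0 : 0 <= cabs (g k) by exact: cabs_ge0.
apply: (@le_trans _ _ (4 * eps * c * al k + 4 * eps * c * cabs (g k) * be k)).
  apply: l2norm_le_comb => [||j _]; rewrite ?mulr_ge0 //.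
  by apply: le_trans (aerr_le j ltk) _; rewrite mulrDr !mulrA.
rewrite mulrDr lerD //.
  by rewrite ler_wpM2r ?l2norm_ge0 // ler_piMr ?cabs_cnorm_le1.
by rewrite ler_wpM2r ?l2norm_ge0 // -mulrA ler_piMr ?cabs_cnormM_le1.
Qed.

Lemma nrm_berr k : (k < n)%N ->
  nrm (berr k) <= 4 * eps * (al k + be k) /\ nrm (berr k) <= 4 * eps * (be k + H * al k).
Proof.
move=> ltk; set c := cabs (cnorm (g k)).
have c0 : 0 <= c by exact: cabs_ge0.
have h0 : 0 <= cabs (g k) by exact: cabs_ge0.
have c1 : c <= 1 by exact: cabs_cnorm_le1.
have h : nrm (berr k) <= 4 * eps * c * be k + 4 * eps * c * cabs (g k) * al k.
  apply: l2norm_le_comb => [||j _]; rewrite ?mulr_ge0 //.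
  by apply: le_trans (berr_le j ltk) _; rewrite mulrDr !mulrA.
split; apply: le_trans h _; rewrite mulrDr.
  rewrite addrC lerD //.
    by rewrite ler_wpM2r ?l2norm_ge0 // -mulrA ler_piMr ?cabs_cnormM_le1.
  by rewrite ler_wpM2r ?l2norm_ge0 // ler_piMr.
rewrite lerD //.
  by rewrite ler_wpM2r ?l2norm_ge0 // ler_piMr.
rewrite [leRHS]mulrA ler_wpM2r ?l2norm_ge0 // ler_pM ?mulr_ge0 ?gH //.
by rewrite ler_piMr.
Qed.

Lemma al_step k : (k < n)%N ->
  al k.+1 <= nrm (fun j => cnorm (g k) * ((ah k)`_j + (g k)^* * (bh k)`_j)) + nrm (aerr k).
Proof.
move=> ltk; rewrite (@eq_l2norm R n.+1 (fun j => (ah k.+1)`_j) (fun j =>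
  cnorm (g k) * ((ah k)`_j + (g k)^* * (bh k)`_j) + aerr k j)) ?l2normD //.
by move=> j _; rewrite /aerr addrC subrK.
Qed.

Lemma be_step k : (k < n)%N ->
  be k.+1 <= nrm (fun j => cnorm (g k) * ((bh k)`_j - g k * (ah k)`_j)) + nrm (berr k).
Proof.
move=> ltk; rewrite l2norm_size // -l2norm_XM_recr.
rewrite (@eq_l2norm R n.+1 (fun j => ('X * bh k.+1)`_j) (fun j =>
  cnorm (g k) * ((bh k)`_j - g k * (ah k)`_j) + berr k j)) ?l2normD //.
by move=> j _; rewrite /berr addrC subrK.
Qed.

Lemma computed_norm k : (k <= n)%N ->
  al k ^+ 2 + be k ^+ 2 <= (1 + 32 * k%:R * eps) ^+ 2.
Proof.
elim: k => [|k IH] ltk.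
  by rewrite !l2norm_size // mulr0 mul0r addr0 expr1n.
have {}IH := IH (ltnW ltk).
have k1 : k%:R <= n%:R :> R by rewrite ler_nat ltnW.
set y := 1 + _ in IH.
have ke : k%:R * eps <= n%:R * eps by rewrite ler_wpM2r.
have ke0 : 0 <= k%:R * eps by rewrite mulr_ge0.
have y0 : 0 <= y by rewrite /y; lra.
have y2 : y <= 2 by rewrite /y; move: neps; lra.
have a0 := l2norm_ge0 n.+1 (fun j => (ah k)`_j).
have b0 := l2norm_ge0 n.+1 (fun j => (bh k)`_j).
have ay : al k <= 2.
  by apply: le_trans y2; rewrite -ler_sqr ?nnegrE //; have := sqr_ge0 (be k); lra.
have by' : be k <= 2.
  by apply: le_trans y2; rewrite -ler_sqr ?nnegrE //; have := sqr_ge0 (al k); lra.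
have := l2norm_rotation n.+1 (g k) (fun j => (ah k)`_j) (fun j => (bh k)`_j).
set u := nrm (fun j => cnorm _ * (_ + _)); set v := nrm (fun j => cnorm _ * (_ - _)) => uv.
have [e1 _] := nrm_berr ltk; have e2 := nrm_aerr ltk.
have r0 := l2norm_ge0 n.+1 (aerr k); have s0 := l2norm_ge0 n.+1 (berr k).
have u0 : 0 <= u by exact: l2norm_ge0. have v0 : 0 <= v by exact: l2norm_ge0.
have h1 : u ^+ 2 + v ^+ 2 <= y ^+ 2 by rewrite uv.
have h2 := sqr_pair_add u0 v0 r0 s0 y0 h1.
have h3 : (al k.+1) ^+ 2 <= (u + nrm (aerr k)) ^+ 2.
  by rewrite ler_sqr ?nnegrE ?l2norm_ge0 ?addr_ge0 // al_step.
have h4 : (be k.+1) ^+ 2 <= (v + nrm (berr k)) ^+ 2.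
  by rewrite ler_sqr ?nnegrE ?l2norm_ge0 ?addr_ge0 // be_step.
apply: le_trans (lerD h3 h4) (le_trans h2 _).
have z0 : 0 <= y + (nrm (aerr k) + nrm (berr k)) by rewrite addr_ge0 // addr_ge0.
have z1 : 0 <= 1 + 32 * k.+1%:R * eps by rewrite addr_ge0 // !mulr_ge0.
rewrite ler_sqr ?nnegrE //.
have h5 : 4 * eps * (al k + be k) <= 4 * eps * 4 by rewrite ler_wpM2l //; lra.
rewrite /y -[k.+1%:R]natr1; lra.
Qed.

Lemma computed_le2 k : (k <= n)%N -> al k <= 2 /\ be k <= 2.
Proof.
move=> lek; have h := computed_norm lek.
have k1 : k%:R <= n%:R :> R by rewrite ler_nat.
have ke : k%:R * eps <= n%:R * eps by rewrite ler_wpM2r.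
have ke0 : 0 <= k%:R * eps by rewrite mulr_ge0.
have y2 : 1 + 32 * k%:R * eps <= 2 by move: neps; lra.
have y0 : 0 <= 1 + 32 * k%:R * eps by lra.
split; apply: le_trans y2; rewrite -ler_sqr ?nnegrE ?l2norm_ge0 //.
  by have := sqr_ge0 (be k); lra.
by have := sqr_ge0 (al k); lra.
Qed.

(** Smallness of [B] must be propagated for a relative estimate. A step adds at most
    [H * al k <= 2 * H] to [be k], and [4 * H] leaves room for rounding. *)
Lemma be_bound k : (k <= n)%N ->
  be k <= (1 + 8 * k%:R * eps) * (be 0 + 4 * k%:R * H).
Proof.
elim: k => [|k IH] ltk; first by rewrite !(mulr0, mul0r) !addr0 mul1r.
have {}IH := IH (ltnW ltk).
have [a2 _] := computed_le2 (ltnW ltk).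
have h1 := be_step ltk; have [_ e1] := nrm_berr ltk.
have h2 : nrm (fun j => cnorm (g k) * ((bh k)`_j - g k * (ah k)`_j)) <= be k + H * al k.
  have := @l2norm_le_comb R n.+1 (fun j => cnorm (g k) * ((bh k)`_j - g k * (ah k)`_j))
    (fun j => (bh k)`_j) (fun j => (ah k)`_j) 1 H ler01 H0.
  rewrite mul1r; apply => j _; rewrite cabsM mul1r.
  apply: le_trans (_ : 1 * cabs ((bh k)`_j - g k * (ah k)`_j) <= _).
    by rewrite ler_wpM2r ?cabs_ge0 ?cabs_cnorm_le1.
  rewrite mul1r; apply: le_trans (cabsB _ _) _; rewrite lerD2l cabsM.
  by rewrite ler_wpM2r ?cabs_ge0 ?gH.
have k1 : k%:R <= n%:R :> R by rewrite ler_nat ltnW.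
have ke : k%:R * eps <= n%:R * eps by rewrite ler_wpM2r.
have ke0 : 0 <= k%:R * eps by rewrite mulr_ge0.
have eps1 : 32 * eps <= 1.
  by apply: le_trans neps; rewrite -mulrA ler_wpM2l // ler_peMl.
have hha : H * al k <= H * 2 by rewrite ler_wpM2l.
have b0 := l2norm_ge0 n.+1 (fun j => (bh 0)`_j).
rewrite -[k.+1%:R]natr1.
have kH : 0 <= k%:R * H by rewrite mulr_ge0.
exact: (be_bound_arith IH h1 e1 h2 ke ke0 eps1 hha b0 kH neps eps0 H0).
Qed.

(** Inverse rotations preserve the joint deviation, so rounding errors merely add up. In the
    component [b] a deviation of [a] enters only multiplied by [g k], which makes that bound
    proportional to [be 0 + n H]. *)
Lemma pull_back_bounds m k : (k + m = n)%N ->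
  let p := layers (ah n, bh n) (mkseq (fun i => g (k + i)%N) m) in
  nrm (fun j => (p.1 - ah k)`_j) ^+ 2 + nrm (fun j => (p.2 - bh k)`_j) ^+ 2 <=
    (32 * m%:R * eps) ^+ 2 /\
  nrm (fun j => (p.2 - bh k)`_j) <= 104 * m%:R * eps * (be 0 + n%:R * H).
Proof.
elim: m k => [|m IH] k Ekm p.
  have -> : k = n by rewrite -Ekm addn0.
  have z0 : nrm (fun j => (0 : {poly R[i]})`_j) = 0.
    by rewrite /l2norm big1 ?sqrtr0 // => j _; rewrite coef0 cabs0 expr0n.
  by rewrite /p /= !subrr z0 !(mulr0, mul0r) expr0n /= addr0.
have ltk : (k < n)%N by lia.
have lemn : (m <= n)%N by lia.
have := IH k.+1; rewrite addSnnS => /(_ Ekm).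
rewrite /p mkseq_cons /= addn0.
rewrite (@eq_mkseq _ (fun i => g (k + i.+1)%N) (fun i => g (k.+1 + i)%N)); last first.
  by move=> i; rewrite addSnnS.
set q := layers _ _ => -[IH1 IH2].
pose da j := (q.1 - ah k.+1)`_j + aerr k j.
pose db j := ('X * (q.2 - bh k.+1))`_j + berr k j.
have Ex j : ('X * (q.2 - bh k.+1))`_j = ('X * q.2)`_j - ('X * bh k.+1)`_j.
  by rewrite mulrBr coefB.
(* A layer with [g k] inverts the rotation with [g k], and is itself the rotation with [- g k]. *)
have Ea j : (cnorm (g k) *: (q.1 - (g k)^* *: ('X * q.2)) - ah k)`_j =
    cnorm (- g k) * (da j + (- g k)^* * db j).
  rewrite cnorm_opp /da /db Ex /aerr /berr !(coefB, coefZ) rmorphN /=.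
  transitivity (cnorm (g k) * (q.1`_j - (g k)^* * ('X * q.2)`_j) -
    cnorm (g k) ^+ 2 * (1 + g k * (g k)^*) * (ah k)`_j); last by ring.
  by rewrite cnorm_sqr mul1r.
have Eb j : (cnorm (g k) *: (g k *: q.1 + 'X * q.2) - bh k)`_j =
    cnorm (- g k) * (db j - (- g k) * da j).
  rewrite cnorm_opp /da /db Ex /aerr /berr !(coefB, coefD, coefN, coefZ).
  transitivity (cnorm (g k) * (g k * q.1`_j + ('X * q.2)`_j) -
    cnorm (g k) ^+ 2 * (1 + g k * (g k)^*) * (bh k)`_j); last by ring.
  by rewrite cnorm_sqr mul1r.
rewrite (eq_l2norm (fun j _ => Ea j)) (eq_l2norm (fun j _ => Eb j)) l2norm_rotation.
have da_le : nrm da <= nrm (fun j => (q.1 - ah k.+1)`_j) + nrm (aerr k).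
  exact: l2normD.
have db_le : nrm db <= nrm (fun j => (q.2 - bh k.+1)`_j) + nrm (berr k).
  apply: le_trans (l2normD _ _ _) _; rewrite lerD2r.
  exact: (l2norm_XnM n.+1 1).
have eb_le : nrm (fun j => cnorm (- g k) * (db j - (- g k) * da j)) <= nrm db + H * nrm da.
  have := @l2norm_le_comb R n.+1 (fun j => cnorm (- g k) * (db j - (- g k) * da j))
    db da 1 H ler01 H0.
  rewrite mul1r; apply => j _; rewrite cabsM mul1r.
  apply: le_trans (_ : 1 * cabs (db j - (- g k) * da j) <= _).
    by rewrite ler_wpM2r ?cabs_ge0 ?cabs_cnorm_le1.
  rewrite mul1r; apply: le_trans (cabsB _ _) _; rewrite lerD2l cabsM cabsN.
  by rewrite ler_wpM2r ?cabs_ge0 ?gH.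
have [a2 b2] := computed_le2 (ltnW ltk).
have bk := be_bound (ltnW ltk).
have [e1 e3] := nrm_berr ltk; have e2 := nrm_aerr ltk.
have r0 := l2norm_ge0 n.+1 (aerr k); have s0 := l2norm_ge0 n.+1 (berr k).
have p0 := l2norm_ge0 n.+1 (fun j => (q.1 - ah k.+1)`_j).
have q0 := l2norm_ge0 n.+1 (fun j => (q.2 - bh k.+1)`_j).
have da0 := l2norm_ge0 n.+1 da; have db0 := l2norm_ge0 n.+1 db.
have b00 := l2norm_ge0 n.+1 (fun j => (bh 0)`_j).
have k1 : k%:R <= n%:R :> R by rewrite ler_nat ltnW.
have k0 : 0 <= k%:R :> R by rewrite ler0n.
have m1 : m%:R <= n%:R :> R by rewrite ler_nat.
have m0 : 0 <= m%:R :> R by rewrite ler0n.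
rewrite -[m.+1%:R]natr1.
exact: (pull_back_arith neps eps0 H0 n1 IH1 IH2 da_le db_le eb_le a2 b2 bk e1 e2 e3
  r0 s0 p0 q0 da0 db0 b00 k1 m1 k0 m0).
Qed.

Lemma backward_error :
  let p := layers (ah n, bh n) (mkseq g n) in
  l2norm n (fun j => (p.1 - ah 0)`_j) <= 32 * n%:R * eps /\
  l2norm n (fun j => (p.2 - bh 0)`_j) <=
    104 * n%:R * eps * (l2norm n (fun j => (bh 0)`_j) + n%:R * H).
Proof.
have [h1 h2] := @pull_back_bounds n 0 erefl.
rewrite -(l2norm_size (sb 0)); split; last first.
  exact: le_trans (l2norm_widen _ (leqnSn n)) h2.
apply: le_trans (l2norm_widen _ (leqnSn n)) _.
rewrite -ler_sqr ?nnegrE ?l2norm_ge0 ?mulr_ge0 //.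
apply: le_trans h1; rewrite lerDl; exact: sqr_ge0.
Qed.

End BackwardError.

(** * The floating-point run *)

Fixpoint ls_state (R : realType) (d : nat -> nat -> nat -> R[i]) (k : nat)
    (a b : nat -> R[i]) (i : nat) : (nat -> R[i]) * (nat -> R[i]) :=
  if i is i'.+1 then
    ls_state d k.+1 (ls_step d k a b).1.2 (ls_step d k a b).2 i'
  else (a, b).

Lemma nth_ls_run (R : realType) d m k (a b : nat -> R[i]) i :
  (i < m)%N ->
  nth 0 (ls_run d m k a b) i =
  (ls_step d (k + i) (ls_state d k a b i).1 (ls_state d k a b i).2).1.1.
Proof.
elim: m k a b i => [//|m IH] k a b [|i] lti; first by rewrite addn0.
by rewrite addnS -addSn -IH.
Qed.

Lemma ls_stateS (R : realType) d k (a b : nat -> R[i]) i :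
  let st := ls_state d k a b in
  st i.+1 = ((ls_step d (k + i) (st i).1 (st i).2).1.2,
             (ls_step d (k + i) (st i).1 (st i).2).2).
Proof.
elim: i k a b => [|i IH] k a b; first by rewrite addn0.
by rewrite /= addnS -addSn -IH.
Qed.

(** The perturbation has modulus at most [e (1 + |g|^2)]. This keeps both the argument of the square
    root and the next pivot [a_0] away from zero. *)
Lemma perturbed_one_addr_neq0 (R : realType) (e : R) (g x y : R[i]) :
  e < 1 -> cabs x <= e -> cabs y <= e -> 1 + x + g * g^* * (1 + y) != 0.
Proof.
move=> e1 hx hy; apply/eqP => h.
have G0 := sqr_ge0 (cabs g).
have E : (1 + cabs g ^+ 2)%:C%C = - (x + g * g^* * y).
  rewrite rmorphD /= cabs_sqr rmorph1; apply/eqP; rewrite -subr_eq0 -h opprK.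
  by apply/eqP; ring.
have := congr1 (@cabs R) E; rewrite cabs_real ?addr_ge0 // cabsN => E'.
have := cabsD x (g * g^* * y); rewrite -E' !cabsM cabs_conj -expr2.
have := ler_wpM2l G0 hy; move: (cabs g ^+ 2) G0 => G.
have := cabs_ge0 x; nra.
Qed.

Lemma cabs_round2 (R : realType) (e : R) (x y : R[i]) :
  e <= 1 / 10 -> cabs x <= e -> cabs y <= e -> cabs ((1 + x) * (1 + y) - 1) <= 21 / 10 * e.
Proof.
move=> e1 hx hy; have -> : (1 + x) * (1 + y) - 1 = x + y + x * y by ring.
have := cabsD (x + y) (x * y); have := cabsD x y; rewrite cabsM.
have := cabs_ge0 x; have := cabs_ge0 y; nra.
Qed.

Lemma cabs_round3 (R : realType) (e : R) (x y z : R[i]) :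
  e <= 1 / 10 -> cabs x <= e -> cabs y <= e -> cabs z <= e ->
  cabs ((1 + x) * (1 + y) * (1 + z) - 1) <= 4 * e.
Proof.
move=> e1 hx hy hz; have := cabs_round2 e1 hx hy; set w := _ - 1 => hw.
have -> : (1 + x) * (1 + y) * (1 + z) - 1 = w + z + w * z by rewrite /w; ring.
have := cabsD (w + z) (w * z); have := cabsD w z; rewrite cabsM.
have := cabs_ge0 w; have := cabs_ge0 z; nra.
Qed.

Definition ls_scale (R : realType) (d : nat -> nat -> nat -> R[i]) (k : nat) (g : R[i]) :=
  fl (d k 4%N 0%N) (1 / fl (d k 3%N 0%N)
    (sqrtC (fl (d k 2%N 0%N) (1 + fl (d k 1%N 0%N) (g * g^*))))).

Lemma ls_stepE (R : realType) d k (a b : nat -> R[i]) :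
  let g := (ls_step d k a b).1.1 in
  [/\ g = b 0%N / a 0%N * (1 + d k 0%N 0%N),
      forall j, (ls_step d k a b).1.2 j = (a j + b j * g^* * (1 + d k 5%N j)) *
        (1 + d k 6%N j) * ls_scale d k g * (1 + d k 7%N j)
    & forall j, (ls_step d k a b).2 j = (b j.+1 - a j.+1 * g * (1 + d k 8%N j.+1)) *
        (1 + d k 9%N j.+1) * ls_scale d k g * (1 + d k 10%N j.+1)].
Proof. by []. Qed.

Lemma one_addr_neq0 (R : realType) (e : R) (x : R[i]) : e < 1 -> cabs x <= e -> 1 + x != 0.
Proof.
move=> e1 hx; have := perturbed_one_addr_neq0 0 e1 hx hx.
by rewrite mul0r mul0r addr0.
Qed.

Lemma ls_scale_neq0 (R : realType) d k (g : R[i]) (e : R) :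
  (forall k o j, cabs (d k o j) <= e) -> e < 1 -> ls_scale d k g != 0.
Proof.
move=> Hd e1; have nz o j := one_addr_neq0 e1 (Hd k o j).
have e0 : 0 <= e := le_trans (cabs_ge0 _) (Hd 0%N 0%N 0%N).
have := perturbed_one_addr_neq0 g e1 (_ : cabs 0 <= e) (Hd k 1%N 0%N).
rewrite cabs0 addr0 => /(_ e0) h.
by rewrite /ls_scale /fl mulf_neq0 // mul1r invr_neq0 // mulf_neq0 // sqrtC_eq0 mulf_neq0.
Qed.

(* The computed reciprocal [ls_scale] need not be close to [cnorm]: for arguments just
   below the positive half-line, [sqrtC] returns the root of negative real part.  But it
   multiplies both columns, so it is divided out and only has to be nonzero. *)
Lemma ls_run_normalize (R : realType) n d (A B : {poly R[i]}) (eps : R) :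
  (forall k o j, cabs (d k o j) <= eps) -> eps <= 1 / 10 ->
  (size A <= n)%N -> (size B <= n)%N -> A`_0 != 0 ->
  let g k := nth 0 (layer_stripping d n A B) k in
  exists ah bh : nat -> {poly R[i]},
  [/\ ah 0%N = A /\ bh 0%N = B,
      forall k, (size (ah k) <= n)%N /\ (size (bh k) <= n)%N,
      (ah n)`_0 != 0,
      forall k j, (k < n)%N ->
        cabs ((ah k.+1)`_j - cnorm (g k) * ((ah k)`_j + (g k)^* * (bh k)`_j)) <=
        4 * eps * cabs (cnorm (g k)) * (cabs (ah k)`_j + cabs (g k) * cabs (bh k)`_j)
    & forall k j, (k < n)%N ->
        cabs (('X * bh k.+1)`_j - cnorm (g k) * ((bh k)`_j - g k * (ah k)`_j)) <=
        4 * eps * cabs (cnorm (g k)) * (cabs (bh k)`_j + cabs (g k) * cabs (ah k)`_j)].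
Proof.
move=> Hd e10 sA sB A0 g.
have e0 : 0 <= eps := le_trans (cabs_ge0 _) (Hd 0%N 0%N 0%N).
have e1 : eps < 1 by lra.
have nz k o j := one_addr_neq0 e1 (Hd k o j).
pose st := ls_state d 0 (fun j => A`_j) (fun j => B`_j).
pose gs k := (ls_step d k (st k).1 (st k).2).1.1.
have Eg k : (k < n)%N -> g k = gs k by move=> ltk; rewrite /g /layer_stripping nth_ls_run.
have Ea k j : (st k.+1).1 j = ((st k).1 j * ((1 + d k 6%N j) * (1 + d k 7%N j)) +
    (gs k)^* * (st k).2 j * ((1 + d k 5%N j) * (1 + d k 6%N j) * (1 + d k 7%N j))) *
    ls_scale d k (gs k).
  have [_ E _] := ls_stepE d k (st k).1 (st k).2.
  by rewrite /st ls_stateS -/st [LHS]E -/(gs k); ring.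
have Eb k j : (st k.+1).2 j = ((st k).2 j.+1 * ((1 + d k 9%N j.+1) * (1 + d k 10%N j.+1)) -
    gs k * (st k).1 j.+1 *
    ((1 + d k 8%N j.+1) * (1 + d k 9%N j.+1) * (1 + d k 10%N j.+1))) *
    ls_scale d k (gs k).
  have [_ _ E] := ls_stepE d k (st k).1 (st k).2.
  by rewrite /st ls_stateS -/st [LHS]E -/(gs k); ring.
have supp k j : (n <= j)%N -> (st k).1 j = 0 /\ (st k).2 j = 0.
  elim: k j => [|k IH] j lej; first by rewrite /= !nth_default ?(leq_trans sA) ?(leq_trans sB).
  have [a0 b0] := IH j lej; have [a1 b1] := IH j.+1 (leqW lej).
  by rewrite Ea Eb a0 b0 a1 b1 !(mulr0, mul0r) subr0 addr0 !mul0r.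
(* Accumulated ratio of computed to exact normalisation; dividing the state by it leaves every
   quotient [b_0 / a_0] unchanged. *)
pose mu k := \prod_(i < k) (ls_scale d i (gs i) / cnorm (gs i)).
have mu0 k : mu k != 0.
  elim: k => [|k IH]; first by rewrite /mu big_ord0 oner_eq0.
  rewrite /mu big_ord_recr /= mulf_neq0 // mulf_neq0 ?(ls_scale_neq0 _ _ Hd) //.
  by rewrite invr_neq0 // cnorm_neq0.
have muS k : (mu k.+1)^-1 * ls_scale d k (gs k) = (mu k)^-1 * cnorm (gs k).
  have := ls_scale_neq0 k (gs k) Hd e1; have := cnorm_neq0 (gs k); have := mu0 k.
  rewrite {2}/mu big_ord_recr /= -/(mu k) => h1 h2 h3.
  by field; rewrite h1 h2 h3.
(* The pivot never vanishes: by the rounded division [b_0 (1 + d_0) = g a_0], the new pivot times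
   [1 + d_0] is a nonzero multiple of [a_0 (1 + d_0 + |g|^2 (1 + d_5))]. *)
have a0 k : (st k).1 0%N != 0.
  elim: k => [//|k IH]; rewrite Ea mulf_neq0 ?(ls_scale_neq0 _ _ Hd) //.
  have E : (st k).2 0%N * (1 + d k 0%N 0%N) = gs k * (st k).1 0%N.
    rewrite /gs /= /fl -!mulrA [_ * (st k).1 _]mulrC mulKf //.
  have h := perturbed_one_addr_neq0 (gs k) e1 (Hd k 0%N 0%N) (Hd k 5%N 0%N).
  apply: contra h => /eqP h; apply/eqP.
  have nz2 : (st k).1 0%N * ((1 + d k 6%N 0%N) * (1 + d k 7%N 0%N)) != 0.
    by rewrite !mulf_neq0.
  apply: (mulfI nz2); rewrite mulr0.
  transitivity ((st k).1 0%N * ((1 + d k 6%N 0%N) * (1 + d k 7%N 0%N)) *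
    (1 + d k 0%N 0%N) + (gs k)^* * (gs k * (st k).1 0%N) *
    ((1 + d k 5%N 0%N) * (1 + d k 6%N 0%N) * (1 + d k 7%N 0%N))); first by ring.
  by rewrite -E -[RHS](mul0r (1 + d k 0%N 0%N)) -[X in _ = X * _]h; ring.
pose ah k := \poly_(j < n) ((mu k)^-1 * (st k).1 j).
pose bh k := \poly_(j < n) ((mu k)^-1 * (st k).2 j).
have Ca k j : (ah k)`_j = (mu k)^-1 * (st k).1 j.
  by rewrite coef_poly; case: ltnP => // /(supp k) [-> _]; rewrite mulr0.
have Cb k j : (bh k)`_j = (mu k)^-1 * (st k).2 j.
  by rewrite coef_poly; case: ltnP => // /(supp k) [_ ->]; rewrite mulr0.
have mu00 : mu 0%N = 1 by rewrite /mu big_ord0.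
have bound (c x y u v : R[i]) :
    cabs u <= 4 * eps -> cabs v <= 4 * eps ->
    forall h, cabs (c * (x * u + h * y * v)) <=
      4 * eps * cabs c * (cabs x + cabs h * cabs y).
  move=> hu hv h; rewrite cabsM [4 * eps * _]mulrC -[leRHS]mulrA ler_wpM2l ?cabs_ge0 //.
  apply: le_trans (cabsD _ _) _; rewrite !cabsM mulrDr lerD //.
    by rewrite mulrC ler_wpM2r ?cabs_ge0.
  by rewrite mulrC ler_wpM2r // mulr_ge0 ?cabs_ge0.
have le2 (x : R) : x <= 21 / 10 * eps -> x <= 4 * eps by move=> h; lra.
exists ah, bh; split.
- split; apply/polyP => j; first by rewrite Ca mu00 invr1 mul1r.
  by rewrite Cb mu00 invr1 mul1r.
- by move=> k; rewrite !size_poly.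
- by rewrite Ca mulf_neq0 // invr_neq0.
- move=> k j ltk; rewrite Eg //.
  have -> : (ah k.+1)`_j - cnorm (gs k) * ((ah k)`_j + (gs k)^* * (bh k)`_j) =
    cnorm (gs k) * ((ah k)`_j * ((1 + d k 6%N j) * (1 + d k 7%N j) - 1) +
      (gs k)^* * (bh k)`_j * ((1 + d k 5%N j) * (1 + d k 6%N j) * (1 + d k 7%N j) - 1)).
    rewrite {1}Ca Ea mulrCA muS !Ca Cb; ring.
  rewrite -[cabs (gs k)]cabs_conj; apply: bound; last exact: cabs_round3.
  exact: le2 (cabs_round2 _ _ _).
- move=> k j ltk; rewrite Eg // coefXM; case: j => [|j] /=.
    (* The discarded entry is zero only in exact arithmetic; here it is a relative error of one
       division, within the same bound. *)
    have -> : 0 - cnorm (gs k) * ((bh k)`_0 - gs k * (ah k)`_0) =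
        cnorm (gs k) * ((bh k)`_0 * d k 0%N 0%N + gs k * (ah k)`_0 * 0).
      have E : (bh k)`_0 * (1 + d k 0%N 0%N) = gs k * (ah k)`_0.
        by rewrite Ca Cb /gs /= /fl; field; rewrite a0 mu0.
      by rewrite -E; ring.
    apply: bound; last by rewrite cabs0; lra.
    by apply: le_trans (Hd _ _ _) _; lra.
  have -> : (bh k.+1)`_j - cnorm (gs k) * ((bh k)`_j.+1 - gs k * (ah k)`_j.+1) =
    cnorm (gs k) * ((bh k)`_j.+1 * ((1 + d k 9%N j.+1) * (1 + d k 10%N j.+1) - 1) +
      (- gs k) * (ah k)`_j.+1 *
      ((1 + d k 8%N j.+1) * (1 + d k 9%N j.+1) * (1 + d k 10%N j.+1) - 1)).
    rewrite {1}Cb Eb mulrCA muS !Cb Ca; ring.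
  rewrite -[cabs (gs k)]cabsN; apply: bound; last exact: cabs_round3.
  exact: le2 (cabs_round2 _ _ _).
Qed.

(** * Forward error *)

(** A purely formal inverse, with no control of size, for the perturbed [A'], whose roots are not
    controlled. *)
Lemma poly_inverse_mod (R : realType) n (a : {poly R[i]}) :
  a`_0 != 0 -> exists v : {poly R[i]},
  forall j, (j < n)%N -> (v * a)`_j = (j == 0%N)%:R.
Proof.
move=> a0; elim: n => [|n [v Hv]]; first by exists 0.
exists (v - (((v * a)`_n - (n == 0%N)%:R) / a`_0) *: 'X^n) => j.
rewrite mulrBl -scalerAl coefB coefZ coefXnM ltnS leq_eqVlt => /orP[/eqP->|ltj].
  by rewrite ltnn subnn divfK // opprB addrC subrK.
by rewrite ltj mulr0 subr0 Hv.
Qed.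

Lemma l2norm_rev (R : realType) k n (p : {poly R[i]}) :
  (k < n)%N -> l2norm k (fun j => p`_(k - j)) <= l2norm n (fun j => p`_j).
Proof.
move=> ltk; apply: le_trans (l2norm_widen _ ltk); apply: ler_wsqrtr.
rewrite [leRHS]big_ord_recl (reindex_inj rev_ord_inj) /=.
under eq_bigr => j _ do rewrite subKn //.
by rewrite lerDr sqr_ge0.
Qed.

(** Splits the difference into [y'] against [f' - f] and [y' - y] against [f]. The factor [sqrt n]
    bounds the operator norm of the Toeplitz matrix of [f' - f] by its Euclidean coefficient
    norm. *)
Lemma gamma_perturbation (R : realType) V V' (s s' : seq R[i]) (a b v a' b' v' : {poly R[i]}) n k :
  layers V s = (a, b) -> layers V' s' = (a', b') -> size s = n -> size s' = n ->
  (forall j, (j < n)%N -> (v * a)`_j = (j == 0%N)%:R) ->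
  (forall j, (j < n)%N -> (v' * a')`_j = (j == 0%N)%:R) ->
  (k < n)%N ->
  forall df, df = l2norm n (fun j => (v' * b' - v * b)`_j) ->
  cabs (nth 0 s' k - nth 0 s k) <=
  df + 2 * Num.sqrt n%:R * l2norm n (fun j => (v * b)`_j) * df.
Proof.
move=> E E' ss ss' Hv Hv' ltk df Edf.
have n0 : (0 < n)%N by exact: leq_ltn_trans ltk.
have df0 : 0 <= df by rewrite Edf; exact: l2norm_ge0.
have f0 := l2norm_ge0 n (fun j => (v * b)`_j).
have nu0 : 0 <= Num.sqrt n%:R :> R by exact: sqrtr_ge0.
case: k ltk => [|k] ltk.
  rewrite (layers_gamma0 E (v := v)) ?ss ?Hv // (layers_gamma0 E' (v := v')) ?ss' ?Hv' //.
  rewrite -coefB; apply: le_trans (cabs_le_l2norm (fun j => (v' * b' - v * b)`_j) n0) _.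
  by rewrite Edf lerDl -Edf !mulr_ge0.
have [||y [Hy ->]] := @layers_gamma R V s a b v k.+1 E; rewrite ?ss //.
have [||y' [Hy' ->]] := @layers_gamma R V' s' a' b' v' k.+1 E'; rewrite ?ss' //.
set f := v * b; set f' := v' * b'.
have HD (u : nat -> R[i]) : l2norm k.+1 (fun i => \sum_(l < k.+1) (toeplitz f' i l - toeplitz f i l) * u l)
    <= Num.sqrt n%:R * df * l2norm k.+1 u.
  pose P := \poly_(l < k.+1) u l.
  have EP l : (l < k.+1)%N -> P`_l = u l by move=> ltl; rewrite coef_poly ltl.
  rewrite -(eq_l2norm EP).
  rewrite (@eq_l2norm R k.+1 _ (fun i => ((f' - f) * P)`_i)); last first.
    move=> i lti; rewrite mulrC -(sum_toeplitz (f' - f) P lti); apply: eq_bigr => l _.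
    rewrite EP // /toeplitz; case: leqP => _; rewrite ?subr0 // coefB //.
  apply: le_trans (l2norm_convolution _ _ _) _; rewrite ler_wpM2r ?l2norm_ge0 //.
  apply: le_trans (l1_le_l2norm k.+1 (fun i => (f' - f)`_i)) _.
  rewrite ler_pM ?sqrtr_ge0 ?l2norm_ge0 ?l2norm_widen ?ler_wsqrtr ?ler_nat // 1?ltnW //.
  by rewrite Edf l2norm_widen // ltnW.
have hy := normal_equation_perturb (mulr_ge0 nu0 df0) Hy Hy' HD.
have [y'1 _] := normal_equation_le1 Hy'.
rewrite -sumrB (eq_bigr (fun j : 'I_k.+1 => y' j * (f' - f)`_(k.+1 - j) +
  (y' j - y j) * f`_(k.+1 - j))); last by move=> j _; rewrite coefB; ring.
rewrite big_split /=; apply: le_trans (cabsD _ _) _; apply: lerD.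
  apply: le_trans (l2norm_CauchySchwarz k.+1 y' (fun j => (f' - f)`_(k.+1 - j))) _.
  by rewrite -[leRHS]mul1r Edf ler_pM ?l2norm_ge0 // l2norm_rev.
apply: le_trans (l2norm_CauchySchwarz k.+1 (fun j => y' j - y j) (fun j => f`_(k.+1 - j))) _.
have -> : 2 * Num.sqrt n%:R * l2norm n (fun j => f`_j) * df =
  2 * (Num.sqrt n%:R * df) * l2norm n (fun j => f`_j) by ring.
by rewrite ler_pM ?l2norm_ge0 // l2norm_rev.
Qed.

(** Rests on [f' - f = G ((B' - B) - (A' - A) f')] mod [z^n]: only the inverse of the unperturbed
    [A] needs a bound, at the cost of [df] on both sides. *)
Lemma quotient_perturbation (R : realType) n (A B A' B' G v' : {poly R[i]}) (K : R) :
  0 <= K ->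
  (forall j, (j < n)%N -> (G * A)`_j = (j == 0%N)%:R) ->
  (forall j, (j < n)%N -> (v' * A')`_j = (j == 0%N)%:R) ->
  (forall z, cabs z = 1 -> cabs G.[z] <= K) ->
  forall df, df = l2norm n (fun j => (v' * B' - G * B)`_j) ->
  df <= K * (l2norm n (fun j => (B' - B)`_j) +
    Num.sqrt n%:R * l2norm n (fun j => (A' - A)`_j) * (l2norm n (fun j => (G * B)`_j) + df)).
Proof.
move=> K0 HG Hv' GK df Edf; set f' := v' * B'.
have {1}-> : df = l2norm n (fun j => (G * ((B' - B) - (A' - A) * f'))`_j).
  rewrite Edf; apply: eq_l2norm => j ltj.
  have -> : G * ((B' - B) - (A' - A) * f') =
      (G * B' + f' * (G * A)) - (G * B' * (v' * A') + G * B) by rewrite /f'; ring.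
  by rewrite !(coefB, coefD, coefN) (coef_mul_unit _ Hv') // (coef_mul_unit _ HG) //; ring.
apply: le_trans (l2norm_multiplier _ _ K0 GK) _; apply: ler_wpM2l => //.
have h := @l2norm_le_comb R n (fun j => ((B' - B) - (A' - A) * f')`_j)
  (fun j => (B' - B)`_j) (fun j => ((A' - A) * f')`_j) 1 1 ler01 ler01.
apply: le_trans (h _) _; first by move=> j _; rewrite !mul1r coefB cabsB.
rewrite !mul1r lerD2l; apply: le_trans (l2norm_convolution _ _ _) _.
apply: ler_pM; rewrite ?l2norm_ge0 ?l1_le_l2norm //.
  by apply: sumr_ge0 => i _; exact: cabs_ge0.
have h2 := l2normD n (fun j => (G * B)`_j) (fun j => (f' - G * B)`_j).
rewrite Edf; apply: le_trans h2; rewrite le_eqVlt; apply/orP; left; apply/eqP.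
by apply: eq_l2norm => j _; rewrite coefB addrC subrK.
Qed.

Lemma one_sub_prod_cnorm (R : realType) (s : seq R[i]) :
  cabs (\prod_(g <- s) cnorm g) ^+ 2 <= 1 /\
  1 - cabs (\prod_(g <- s) cnorm g) ^+ 2 <= \sum_(g <- s) cabs g ^+ 2.
Proof.
elim: s => [|g s [IH1 IH2]]; first by rewrite !big_nil cabs1 expr1n subrr.
rewrite !big_cons cabsM exprMn.
have := cabs_cnorm_sqr g; have := sqr_ge0 (cabs g); have := sqr_ge0 (cabs (cnorm g)).
have := sqr_ge0 (cabs (\prod_(j <- s) cnorm j)).
move: (cabs g ^+ 2) (cabs (cnorm g) ^+ 2) (cabs _ ^+ 2) (\sum_(j <- s) _) IH1 IH2.
clear => x c P S IH1 IH2 P0 c0 x0 E.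
have E2 : P = c * P + c * x * P by rewrite -{1}[P]mul1r -E; ring.
have c1 : c <= 1 by have := mulr_ge0 c0 x0; lra.
have h1 := ler_wpM2l c0 IH1; have h2 := ler_wpM2r x0 c1.
have h3 : c * x * P <= c * x * 1 by rewrite ler_wpM2l // mulr_ge0.
split; lra.
Qed.

Lemma circle_identity (R : realType) (A B : {poly R[i]}) (z : R[i]) :
  star A z * A.[z] + B.[z] * star B z = 1 -> cabs z = 1 ->
  cabs A.[z] ^+ 2 + cabs B.[z] ^+ 2 = 1.
Proof.
move=> H z1; apply: (@complexI R); rewrite rmorphD /= !cabs_sqr rmorph1 -[RHS]H.
have st (P : {poly R[i]}) : star P z = (P.[z])^*.
  rewrite /star; have -> : ((z^*)%R)^-1 = z; last by [].
  by rewrite conj_unit_circle // invrK.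
by rewrite !st mulrC.
Qed.

Lemma l2norm_circle_identity (R : realType) n (A B : {poly R[i]}) :
  (0 < n)%N -> (size A <= n)%N -> (size B <= n)%N ->
  (forall z : R[i], cabs z = 1 -> cabs A.[z] ^+ 2 + cabs B.[z] ^+ 2 = 1) ->
  l2norm n (fun j => A`_j) ^+ 2 + l2norm n (fun j => B`_j) ^+ 2 = 1.
Proof.
move=> n0 sA sB H; have [w pw] := complex_prim_root_exists R n0.
have n1 : n%:R != 0 :> R by rewrite pnatr_eq0 -lt0n.
apply: (mulfI n1); rewrite mulrDr -!(parseval_prim_root pw) // -big_split /=.
under eq_bigr => i _ do rewrite H ?cabsX ?(cabs_prim_root pw) ?expr1n //.
by rewrite sumr_const card_ord mulr1.
Qed.

(** Here [nu = sqrt n], [h = eta^(-1/2)], [p0] and [q0] are the backward errors in [A] and [B],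
    [phi] and [df] the norms of the quotient and of its change, [Del] the final error. The power
    [nu^6] is [nu^4] from [q0], one [nu] from the Toeplitz norm and one from summing [n] entries.
    Each use of [G] costs one [h]. *)
Lemma stability_arith (R : realType) (nu h e Gam Gam' Del b0 p0 q0 phi df : R) :
  1 <= nu -> 1 <= h -> 0 <= e -> 0 <= Gam' -> 0 <= b0 -> 0 <= df -> 0 <= Gam ->
  0 <= phi -> 0 <= Del ->
  b0 <= Gam -> b0 <= 1 -> p0 <= 32 * nu ^+ 2 * e ->
  q0 <= 104 * nu ^+ 2 * e * (b0 + nu ^+ 2 * Gam') ->
  df <= 2 * h * (q0 + nu * p0 * (phi + df)) -> phi <= 2 * h * b0 ->
  Del <= nu * (df + 2 * nu * phi * df) -> Gam' <= Gam + Del ->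
  nu ^+ 6 * h ^+ 5 * e <= 1 / 10000 ->
  Del <= 13440 * (nu ^+ 6 * h ^+ 5 * e) * Gam.
Proof.
move=> nu1 h1 e0 G0' b00 df0 G0 phi0 D0 bG b1 hp hq hdf hphi hD hG' hX.
set X := nu ^+ 6 * h ^+ 5 * e in hX *.
have nu0 : 0 <= nu by lra. have h0 : 0 <= h by lra.
have X0 : 0 <= X by rewrite !mulr_ge0 ?exprn_ge0.
have up (t s : R) : 0 <= t -> 1 <= s -> t <= t * s by move=> *; rewrite ler_peMr.
have x1 : h * nu ^+ 3 * e <= X.
  have -> : X = h * nu ^+ 3 * e * (nu ^+ 3 * h ^+ 4) by rewrite /X; ring.
  by rewrite up ?mulr_ge0 ?exprn_ge0 // mulr_ege1 // exprn_ege1.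
have hp' : 2 * h * (nu * p0) <= 64 * (h * nu ^+ 3 * e).
  have -> : 64 * (h * nu ^+ 3 * e) = 2 * h * (nu * (32 * nu ^+ 2 * e)) by ring.
  by rewrite ler_wpM2l ?mulr_ge0 // ler_wpM2l.
have half : 2 * h * (nu * p0) * df <= 1 / 2 * df by rewrite ler_wpM2r //; lra.
have hdf2 : df <= 4 * h * q0 + 2 * (2 * h * (nu * p0)) * phi by move: hdf half; lra.
have hq' : 4 * h * q0 <= 4 * h * (104 * nu ^+ 2 * e * (b0 + nu ^+ 2 * Gam')).
  by rewrite ler_wpM2l // mulr_ge0.
set Y := h ^+ 2 * nu ^+ 4 * e.
have Y0 : 0 <= Y by rewrite !mulr_ge0 ?exprn_ge0.
have y1 : h * nu ^+ 2 * e * b0 <= Y * b0.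
  have -> : Y * b0 = h * nu ^+ 2 * e * b0 * (h * nu ^+ 2) by rewrite /Y; ring.
  by rewrite up ?mulr_ge0 ?exprn_ge0 // mulr_ege1 // exprn_ege1.
have y2 : h * nu ^+ 4 * e * Gam' <= Y * Gam'.
  have -> : Y * Gam' = h * nu ^+ 4 * e * Gam' * h by rewrite /Y; ring.
  by rewrite up ?mulr_ge0 ?exprn_ge0.
have y3 : h ^+ 2 * nu ^+ 3 * e * b0 <= Y * b0.
  have -> : Y * b0 = h ^+ 2 * nu ^+ 3 * e * b0 * nu by rewrite /Y; ring.
  by rewrite up ?mulr_ge0 ?exprn_ge0.
have hphi' : 2 * (2 * h * (nu * p0)) * phi <= 256 * (h ^+ 2 * nu ^+ 3 * e * b0).
  have -> : 256 * (h ^+ 2 * nu ^+ 3 * e * b0) =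
    2 * (64 * (h * nu ^+ 3 * e)) * (2 * h * b0) by ring.
  apply: (@le_trans _ _ (2 * (64 * (h * nu ^+ 3 * e)) * phi)).
    by rewrite ler_wpM2r // ler_wpM2l.
  by rewrite ler_wpM2l // !mulr_ge0 ?exprn_ge0.
have Yb : Y * b0 <= Y * Gam by rewrite ler_wpM2l.
have hdf3 : df <= 672 * (Y * (Gam + Gam')).
  have := mulr_ge0 Y0 G0'; move: hdf2 hq' y1 y2 y3 hphi' Yb; clear; lra.
(* The factor multiplying [df] uses [b0 <= 1], whereas the bound on [df] used [b0 <= Gam]: one
   factor [Gam] or [Gam'] is all that is wanted. *)
have hb1 : h * b0 <= h * 1 by rewrite ler_wpM2l.
have hD2 : Del <= 5 * (h * nu ^+ 2) * df.
  apply: le_trans hD _.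
  have -> : nu * (df + 2 * nu * phi * df) = (nu + 2 * nu ^+ 2 * phi) * df by ring.
  rewrite ler_wpM2r //.
  have k1 : nu <= h * nu ^+ 2.
    have -> : h * nu ^+ 2 = nu * (h * nu) by ring.
    by rewrite up // mulr_ege1.
  have k2 : nu ^+ 2 * phi <= nu ^+ 2 * (2 * h) by rewrite ler_wpM2l ?exprn_ge0 //; lra.
  move: k1 k2; clear; lra.
have hD3 : Del <= 3360 * (X * (Gam + Gam')).
  apply: le_trans hD2 _; apply: (@le_trans _ _ (5 * (h * nu ^+ 2) * (672 * (Y * (Gam + Gam'))))).
    by rewrite ler_wpM2l // !mulr_ge0 ?exprn_ge0.
  have z1 : h ^+ 3 * nu ^+ 6 * e * (Gam + Gam') <= X * (Gam + Gam').
    rewrite ler_wpM2r ?addr_ge0 //.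
    have -> : X = h ^+ 3 * nu ^+ 6 * e * h ^+ 2 by rewrite /X; ring.
    by rewrite up ?mulr_ge0 ?exprn_ge0 // exprn_ege1.
  have -> : 5 * (h * nu ^+ 2) * (672 * (Y * (Gam + Gam'))) =
    3360 * (h ^+ 3 * nu ^+ 6 * e * (Gam + Gam')) by rewrite /Y; ring.
  by rewrite ler_wpM2l.
have hXG : X * Gam' <= X * (Gam + Del) by rewrite ler_wpM2l.
have hXD : X * Del <= 1 / 10000 * Del by rewrite ler_wpM2r.
(* The right side contains [Del] with coefficient at most [0.336 < 1/2]; absorbing it doubles
   [2 * 3360] to [13440]. *)
move: hD3 hXG hXD (mulr_ge0 X0 G0) D0; clear; lra.
Qed.

Local Open Scope complex_scope.
Theorem theorem5p5 (R : realType) :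
  exists c Cst : R, 0 < c /\ 0 < Cst /\
  forall (n : nat) (eta eps : R) (A B : {poly R[i]}),
    (0 < n)%N ->
    0 < eta < 1 ->
    (* (a, b) in S: a a^* + b b^* = 1 (as Laurent polynomials), where a^* = A *)
    (forall z : R[i], z != 0 -> star A z * A.[z] + B.[z] * star B z = 1) ->
    (* 0 < a^*(0) < oo *)
    0 < A.[0] ->
    (* b polynomial with 0 < sup_{|z|=1} |b(z)| <= 1 - eta *)
    (exists z : R[i], cabs z = 1 /\ 0 < cabs B.[z]) ->
    (forall z : R[i], cabs z = 1 -> cabs B.[z] <= 1 - eta) ->
    (* deg b <= n - 1 *)
    (size B <= n)%N ->
    (* a^* is outer *)
    (forall z : R[i], cabs z < 1 -> A.[z] != 0) ->
    (* gam is the inverse NLFT of (a, b) *)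
    forall (gam : int -> R[i]) (N : nat),
    (forall k : int, (N < `|k|)%N -> gam k = 0) ->
    (forall z : R[i], z != 0 ->
       nlft N gam z = mx2 (star A z) B.[z] (- star B z) A.[z]) ->
    (* floating-point run with machine precision eps, any admissible roundings *)
    forall d : nat -> nat -> nat -> R[i],
    (forall k o j, cabs (d k o j) <= eps) ->
    n%:R ^+ 3 * (Num.sqrt eta) ^- 5 * eps <= c ->
    let ghat := layer_stripping d n A B in
    l2norm n (fun k => nth 0 ghat k - gam k%:Z) / l2norm n (fun k => gam k%:Z)
      <= Cst * n%:R ^+ 3 * (Num.sqrt eta) ^- 5 * eps.
Proof.
exists (1 / 10000), 13440; split; first by lra.
split; first by lra.
move=> n eta eps A B n0 /andP[eta0 eta1] HAB A00 _ HB sB HA gam N supp HN d Hd hc; cbv zeta.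
set ghat := layer_stripping d n A B.
have eps0 : 0 <= eps := le_trans (cabs_ge0 _) (Hd 0%N 0%N 0%N).
set h := (Num.sqrt eta)^-1; set nu : R := Num.sqrt n%:R.
have se0 : 0 < Num.sqrt eta by rewrite sqrtr_gt0.
have se1 : Num.sqrt eta <= 1 by rewrite -sqrtr1 ler_wsqrtr // ltW.
have h1 : 1 <= h by rewrite -[leLHS]invr1 lef_pV2 ?posrE.
have n1 : 1 <= n%:R :> R by rewrite ler1n.
have nu2 : nu ^+ 2 = n%:R by rewrite sqr_sqrtr ?ler0n.
have nu1 : 1 <= nu by rewrite -sqrtr1 ler_wsqrtr.
have EX : n%:R ^+ 3 * (Num.sqrt eta) ^- 5 * eps = nu ^+ 6 * h ^+ 5 * eps.
  by rewrite -nu2 -exprM -exprVn.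
have nepsX : n%:R * eps <= 1 / 10000.
  apply: le_trans hc; rewrite EX -nu2 ler_wpM2r //.
  have -> : nu ^+ 6 * h ^+ 5 = nu ^+ 2 * (nu ^+ 4 * h ^+ 5) by ring.
  by rewrite ler_peMr ?sqr_ge0 // mulr_ege1 // exprn_ege1.
have eps1 : eps <= n%:R * eps by rewrite ler_peMl.
have Elay := nlft_eq_foldr_layer sB supp HN.
set sg := mkseq (fun i => gam i%:Z) n in Elay.
have sA : (size A <= n)%N.
  have := proj1 (size_foldr_layer sg).
  by rewrite Elay size_mkseq (maxn_idPr n0).
have circ z : cabs z = 1 -> cabs A.[z] ^+ 2 + cabs B.[z] ^+ 2 = 1.
  move=> z1; apply: circle_identity (z1); apply: HAB.
  by rewrite -cabs_eq0 z1 oner_eq0.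
have lowA z : cabs z = 1 -> 1 <= h * cabs A.[z].
  move=> z1; have e := circ z z1; have hb := HB z z1.
  (* On the circle [|A|^2 >= 1 - (1 - eta)^2 = eta (2 - eta) >= eta]. *)
  have hA : Num.sqrt eta <= cabs A.[z].
    rewrite -[cabs A.[z]]ger0_norm ?cabs_ge0 // -sqrtr_sqr ler_wsqrtr //.
    have := cabs_ge0 B.[z]; nra.
  by rewrite -(mulVf (negbT (gt_eqF se0))) ler_wpM2l // invr_ge0 ltW.
have outA z : cabs z <= 1 -> A.[z] != 0.
  rewrite le_eqVlt => /orP[/eqP z1|]; last exact: HA.
  have := lowA z z1; apply: contraTneq => ->; rewrite cabs0 mulr0.
  by rewrite -ltNge ltr01.
have [G [GA GK]] := outer_poly_inverse n outA lowA.
have ab1 := l2norm_circle_identity n0 sA sB circ.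
have A0 : A`_0 != 0 by rewrite -horner_coef0 outA // cabs0.
have Hgam : l2norm n (fun j => B`_j) <= l2norm n (fun k => gam k%:Z).
  apply: l2norm_le_of_sqr; first exact: l2norm_ge0.
  rewrite -l2norm_sqr [leRHS]l2norm_sqr.
  have [_] := one_sub_prod_cnorm sg.
  have := foldr_layer_coef0 (1, 0) sg; rewrite Elay /= coef1 mulr1 => <-.
  rewrite big_map -(big_mkord xpredT (fun k => cabs (gam k%:Z) ^+ 2)) /index_iota subn0.
  apply: le_trans; rewrite -ab1 addrAC lerDr subr_ge0.
  by rewrite ler_sqr ?nnegrE ?cabs_ge0 ?l2norm_ge0 // (cabs_le_l2norm (fun j => A`_j)).
have b1 : l2norm n (fun j => B`_j) <= 1.
  rewrite -(ler_sqr (l2norm_ge0 _ _)) ?nnegrE // expr1n -ab1 lerDr; exact: sqr_ge0.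
have e10 : eps <= 1 / 10 by lra.
have [ah [bh [[ah0 bh0] sab ahn ea eb]]] := ls_run_normalize Hd e10 sA sB A0.
pose g k := nth 0 ghat k; pose H := l2norm n g.
have gH k : (k < n)%N -> cabs (g k) <= H by move=> ltk; exact: cabs_le_l2norm.
have neps : 32 * n%:R * eps <= 1 by lra.
have ab1' : l2norm n (fun j => (ah 0)`_j) ^+ 2 + l2norm n (fun j => (bh 0)`_j) ^+ 2 <= 1.
  by rewrite ah0 bh0 ab1.
have [] := backward_error eps0 neps n0 (fun k => proj1 (sab k)) (fun k => proj2 (sab k))
  ab1' gH ea eb.
rewrite ah0 bh0; set p := layers _ _ => hp hq.
have pn : p.1`_0 != 0.
  by rewrite foldr_layer_coef0 mulf_neq0 ?prod_cnorm_neq0.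
have [v Hv] := poly_inverse_mod n pn.
have h20 : 0 <= 2 * h by lra.
have hdf := quotient_perturbation h20 GA Hv GK erefl (B := B) (B' := p.2).
have hphi := l2norm_multiplier n B h20 GK.
set df := l2norm n _ in hdf; set phi := l2norm n (fun j => (G * B)`_j) in hdf hphi.
have df0 : 0 <= df by exact: l2norm_ge0.
have phi0 : 0 <= phi by exact: l2norm_ge0.
(* The two sequences are compared with different terminal pairs, [(1, 0)] and [(ah n, bh n)]. *)
have hk k : (k < n)%N -> cabs (nth 0 ghat k - gam k%:Z) <= df + 2 * nu * phi * df.
  move=> ltk; have := @gamma_perturbation R (1, 0) (ah n, bh n) sg (mkseq g n) A B G
    p.1 p.2 v n k Elay (surjective_pairing p) (size_mkseq _ _) (size_mkseq _ _) GA Hv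
    ltk df erefl.
  by rewrite !nth_mkseq.
have hD := l2norm_le_const _ hk.
have bnd0 : 0 <= df + 2 * nu * phi * df.
  by rewrite addr_ge0 // !mulr_ge0 // sqrtr_ge0.
have {hD} := hD bnd0; set Del := l2norm n _; set Gam := l2norm n _ => hD.
have hH : H <= Gam + Del.
  rewrite /H (_ : l2norm n g = l2norm n (fun k => gam k%:Z + (nth 0 ghat k - gam k%:Z))).
    exact: l2normD.
  by apply: eq_l2norm => k _; rewrite addrC subrK.
have fin : Del <= 13440 * (nu ^+ 6 * h ^+ 5 * eps) * Gam.
  apply: (@stability_arith R nu h eps Gam H Del (l2norm n (fun j => B`_j)) _ _ phi df _ _ _
    _ _ _ _ _ _ Hgam b1 _ _ hdf hphi hD hH) => //; rewrite ?l2norm_ge0 ?nu2 -?EX //.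
have EC : 13440 * n%:R ^+ 3 * (Num.sqrt eta) ^- 5 * eps =
    13440 * (nu ^+ 6 * h ^+ 5 * eps) by rewrite -EX; ring.
have X0 : 0 <= nu ^+ 6 * h ^+ 5 * eps.
  by rewrite !mulr_ge0 ?exprn_ge0 // (le_trans ler01).
(* Division by zero returns [0], so this case reduces to nonnegativity of the bound. *)
rewrite EC; have [G0|Gn0] := eqVneq Gam 0; first by rewrite G0 invr0 mulr0 mulr_ge0.
have Gp : 0 < Gam by rewrite lt_def Gn0 l2norm_ge0.
by rewrite ler_pdivrMr.
Qed.
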